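(* Let $K$ be a number field of degree $n$ and $g\ge 2$. Assume Schinzel's hypothesis H for $K$. Then \[ c_K(g) \leq \sum_{d \in D_g} \frac{n}{[K(\zeta_d):\mathbb{Q}(\zeta_d)]} + 1 + n\,\pi(2g), \] where $D_g$ is the set of positive integers $d$ such that either $1 \le d < g$, or $d < 2g$ and $d$ is even.
   Context: $\zeta_d$ is a primitive $d$-th root of unity and $\pi(x)$ is the number of rational primes $\le x$. $c_K(g)$ is the smallest integer $m$ such that there exist infinitely many $\overline{K}$-isomorphism classes of genus $g$ hyperelliptic curves $C/K$ with all Weierstrass points in $K$ having potentially good reduction outside some set of $m$ primes of $K$. An element $x\in\mathcal{O}_K$ is prime if $(x)$ is a prime ideal. Schinzel's hypothesis H for $K$: for every collection $(f_1,\dots,f_k)$ of distinct nonconstant irreducible polynomials in $\mathcal{O}_K[x]$ such that for every prime $\mathfrak{p}$ of $K$ there is $m\in\mathcal{O}_K$ with $v_\mathfrak{p}(f_1(m)\cdots f_k(m)) = 0$, there exist infinitely many $x \in \mathcal{O}_K$ such that each of $f_1(x),\dots,f_k(x)$ is prime. *)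

(* Defs.v *)
From mathcomp Require Import all_boot all_order all_algebra all_field.
From mathcomp Require Import boolp classical_sets functions cardinality.

Set Implicit Arguments.
Unset Strict Implicit.
Unset Printing Implicit Defensive.

Import Order.TTheory GRing.Theory Num.Theory.

Local Open Scope classical_set_scope.
Local Open Scope ring_scope.

(* A number field is a K : fieldExtType rat. Subrings and ideals are sets of
   elements of K. *)

Definition ring_of_integers (K : fieldExtType rat) : set K :=
  [set x | integralOver (intr : int -> K) x].
Arguments ring_of_integers K : clear implicits.

Section Primes.
Variable K : fieldExtType rat.
Local Notation OK := (ring_of_integers K).

Definition is_ideal (I : set K) : Prop :=
  [/\ I `<=` OK, I 0, forall x y, I x -> I y -> I (x + y)
    & forall a x, OK a -> I x -> I (a * x)].

(* The primes of K are the nonzero prime ideals. *)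
Definition is_prime (p : set K) : Prop :=
  [/\ is_ideal p, exists2 x, p x & x != 0, ~ p 1
    & forall x y, OK x -> OK y -> p (x * y) -> p x \/ p y].

Definition principal_ideal (x : K) : set K := [set a * x | a in OK].

Definition prime_element (x : K) : Prop := OK x /\ is_prime (principal_ideal x).

Definition ideal_mul (I J : set K) : set K :=
  [set x | exists2 s : seq (K * K),
     (forall ab, ab \in s -> I ab.1 /\ J ab.2) & x = \sum_(ab <- s) ab.1 * ab.2].

Definition ideal_exp (I : set K) (n : nat) : set K := iter n (ideal_mul I) OK.

(* v_p(x) = n, for x in O_K *)
Definition has_valuation (p : set K) (x : K) (n : nat) : Prop :=
  ideal_exp p n x /\ ~ ideal_exp p n.+1 x.

Definition local_ring (p : set K) : set K :=
  [set x | exists a s, [/\ OK a, OK s, ~ p s & x = a / s]].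

(* "Irreducible" is irreducibility over K: for polynomials satisfying the local
   condition it implies irreducibility in the ring O_K[x], and it is the weaker
   of the two resulting hypotheses. *)
Definition schinzel_hypothesis : Prop :=
  forall fs : seq {poly K},
    uniq fs ->
    (forall f, f \in fs ->
       [/\ forall i, OK f`_i, (1 < size f)%N & irreducible_poly f]) ->
    (forall p, is_prime p ->
       exists2 m, OK m & has_valuation p (\prod_(f <- fs) f.[m]) 0) ->
    infinite_set [set x | OK x /\ forall f, f \in fs -> prime_element f.[x]].

End Primes.

Arguments schinzel_hypothesis K : clear implicits.

(* The equation y^2 + h(x) y = f(x). *)
Record weq (k : nzRingType) := Weq { weq_h : {poly k}; weq_f : {poly k} }.

Definition map_weq (k E : nzRingType) (phi : k -> E) (W : weq k) : weq E :=
  Weq (map_poly phi (weq_h W)) (map_poly phi (weq_f W)).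

Section Weierstrass.
Variables (g : nat) (k : fieldType).
Implicit Type W : weq k.

Definition weq_degree W : Prop :=
  (size (weq_h W) <= g.+2)%N /\ (size (weq_f W) <= (2 * g).+3)%N.

Definition rev_poly (m : nat) (p : {poly k}) : {poly k} :=
  \poly_(i < m.+1) p`_(m - i).

(* The chart at infinity u = 1 / x, v = y / x ^ (g + 1) of the projective curve
   y^2 + h y = f in the weighted projective plane P(1, g + 1, 1). *)
Definition weq_infty W : weq k :=
  Weq (rev_poly g.+1 (weq_h W)) (rev_poly (2 * g).+2 (weq_f W)).

Definition on_curve W (x y : k) : Prop :=
  y ^+ 2 + (weq_h W).[x] * y = (weq_f W).[x].

(* (x, y) is fixed by the hyperelliptic involution y |-> - y - h(x). *)
Definition weierstrass_point W (x y : k) : Prop :=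
  on_curve W x y /\ y *+ 2 + (weq_h W).[x] = 0.

Definition singular_point W (x y : k) : Prop :=
  [/\ on_curve W x y, y *+ 2 + (weq_h W).[x] = 0
    & (weq_h W)^`().[x] * y = (weq_f W)^`().[x]].

(* Over an algebraically closed k, smoothness of the projective curve. *)
Definition smooth_weq W : Prop :=
  (forall x y, ~ singular_point W x y) /\
  (forall u v, ~ singular_point (weq_infty W) u v).

End Weierstrass.

(* E is the function field k(x, y) of the curve W over k, k being embedded in E
   by i. *)
Definition generic_point (k E : fieldType) (i : {rmorphism k -> E})
    (W : weq k) (x y : E) : Prop :=
  [/\ ~ algebraicOver i x, on_curve (map_weq i W) x y
    & forall z, exists p q r : {poly k},
        r != 0 /\ z = ((map_poly i p).[x] + (map_poly i q).[x] * y)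
                      / (map_poly i r).[x]].

(* Smooth projective curves over k are isomorphic over k iff they have the same
   function field over k. *)
Definition isomorphic (k : fieldType) (W1 W2 : weq k) : Prop :=
  exists (E : fieldType) (i : {rmorphism k -> E}) (x1 y1 x2 y2 : E),
    generic_point i W1 x1 y1 /\ generic_point i W2 x2 y2.

Section GoodReduction.
Variables (g : nat) (L : fieldExtType rat) (P : set L).

(* phi is constrained on the local ring at P only, where it is a ring morphism to
   E with kernel the maximal ideal, i.e. an E-valued point of Spec of the local
   ring lying over its closed point. *)
Definition residue_morphism (E : fieldType) (phi : L -> E) : Prop :=
  [/\ phi 1 = 1,
      forall x y, local_ring P x -> local_ring P y -> phi (x + y) = phi x + phi y,
      forall x y, local_ring P x -> local_ring P y -> phi (x * y) = phi x * phi y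
    & forall x, P x -> phi x = 0].

(* C has a Weierstrass model over the local ring at P whose special fibre is
   smooth. *)
Definition good_reduction (C : weq L) : Prop :=
  exists W : weq L,
    [/\ weq_degree g W,
        forall i, local_ring P (weq_h W)`_i /\ local_ring P (weq_f W)`_i,
        isomorphic C W
      & forall (E : closedFieldType) (phi : L -> E),
          residue_morphism phi -> smooth_weq g (map_weq phi W)].

End GoodReduction.

(* The primes P of L over p are the primes P whose preimage in K is p. *)
Definition potentially_good_reduction (g : nat) (K : fieldExtType rat)
    (p : set K) (C : weq K) : Prop :=
  exists (L : fieldExtType rat) (j : 'AHom(K, L)) (P : set L),
    [/\ is_prime P, p = j @^-1` P & good_reduction g P (map_weq j C)].

Section Curves.
Variables (g : nat) (K : fieldExtType rat) (Kbar : closedFieldType).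
Variable iota : {rmorphism K -> Kbar}.

(* A hyperelliptic curve with a Weierstrass point in K is a double cover of P^1
   over K, hence has such an equation. *)
Definition hyperelliptic_curve (C : weq K) : Prop :=
  weq_degree g C /\ smooth_weq g (map_weq iota C).

Definition rational_weierstrass_points (C : weq K) : Prop :=
  forall x y : Kbar,
    weierstrass_point (map_weq iota C) x y \/
    weierstrass_point (weq_infty g (map_weq iota C)) x y ->
    range iota x /\ range iota y.

Definition geometric_class (C : weq K) : set (weq K) :=
  [set C' | hyperelliptic_curve C' /\
            isomorphic (map_weq iota C) (map_weq iota C')].

(* The set S of exceptional primes may depend on the curve. *)
Definition potentially_good_outside (m : nat) (C : weq K) : Prop :=
  exists S : set (set K),
    [/\ S `<=` @is_prime K, (S #= `I_m)%card
      & forall p, is_prime p -> ~ S p -> potentially_good_reduction g p C].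

Definition infinitely_many_classes (m : nat) : Prop :=
  infinite_set [set geometric_class C | C in
    [set C | [/\ hyperelliptic_curve C, rational_weierstrass_points C
               & potentially_good_outside m C]]].

(* c_K(g) = c *)
Definition is_c_K (c : nat) : Prop :=
  infinitely_many_classes c /\
  forall m, infinitely_many_classes m -> (c <= m)%N.

End Curves.

Definition prime_pi (x : nat) : nat := count prime (iota 0 x.+1).

Definition D_g (g : nat) : pred nat :=
  [pred d | (0 < d)%N && ((d < g) || ((d < 2 * g) && ~~ odd d))%N].

(* Main.v *)
(** For t in K, the curve y^2 = x * prod_(i < g) (x^2 - t^(2i)) has its branch
points 0, oo and +-t^i in K, and their differences are products of 2, of powers
of t and of factors t^i +- 1.  Hence it has good reduction at every prime not
dividing 2, t or t^(2i) - 1 for 0 < i < g.  The roots of X^(2i) - 1 are roots of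
unity of order in D_g, and Phi_d has n / [K(zeta_d) : Q(zeta_d)] irreducible
factors over K.  Put t = (2g)! x: hypothesis H provides infinitely many x for
which x and the values at t of all these factors are prime, the local condition
holding because a primitive root modulo a prime l > 2g has order l - 1 >= 2g,
and because the factors take unit values at the primes above l <= 2g.  There are
at most n primes of K above each l.

Only finitely many of these curves are isomorphic to a given one: if y1^2 = f1(x1) and y2^2 = f2(x2)
generate the same field, Gauss's lemma gives an equation of bidegree (2, 2)
between x1 and x2, whose discriminant in x2 has degree at most 4; as it would
vanish at all the roots of f1 if x2 were not in k(x1), x2 is in k(x1), and by
symmetry x2 is a Moebius function of x1, which maps branch points to branch
points. *)

Require Import Defs.
From HB Require Import structures.
From mathcomp Require Import all_boot all_order all_algebra all_field.
From mathcomp Require Import zify ring.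
From mathcomp Require Import boolp classical_sets functions cardinality.

Set Implicit Arguments.
Unset Strict Implicit.
Unset Printing Implicit Defensive.

Import Order.TTheory GRing.Theory Num.Theory.
Local Open Scope ring_scope.

(** * Primes of a number field *)

(** A boolean form of integrality, so that it carries a subring structure. The field is arbitrary
    because integrality is also tested in an algebraically closed field. *)
Definition integers_pred (K : fieldType) : {pred K} :=
  fun x => `[< integralOver (intr : int -> K) x >].
Arguments integers_pred K : clear implicits.

Lemma integral_inP (K : fieldType) (x : K) :
  reflect (integralOver (intr : int -> K) x) (x \in integers_pred K).
Proof. exact: asboolP. Qed.

Lemma integersP (K : fieldExtType rat) (x : K) :
  reflect (ring_of_integers K x) (x \in integers_pred K).
Proof. exact: integral_inP. Qed.

Lemma integers_subring_closed (K : fieldType) : subring_closed (integers_pred K).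
Proof.
split=> [|x y|x y].
- exact/integral_inP/integral1.
- by move=> /integral_inP Ox /integral_inP Oy; apply/integral_inP/integral_sub.
- by move=> /integral_inP Ox /integral_inP Oy; apply/integral_inP/integral_mul.
Qed.
HB.instance Definition _ (K : fieldType) :=
  GRing.isSubringClosed.Build K (integers_pred K) (@integers_subring_closed K).

Section PrimeIdeals.
Variables (K : fieldExtType rat) (p : set K).
Hypothesis p_prime : is_prime p.

Lemma prime_integer x : p x -> x \in integers_pred K.
Proof. by case: p_prime => -[pO _ _ _] _ _ _ /pO/integersP. Qed.

Lemma prime0 : p 0. Proof. by case: p_prime => -[]. Qed.

Lemma prime1 : ~ p 1. Proof. by case: p_prime. Qed.

Lemma primeD x y : p x -> p y -> p (x + y).
Proof. by case: p_prime => -[_ _ pD _] _ _ _; apply: pD. Qed.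

Lemma primeMl a x : a \in integers_pred K -> p x -> p (a * x).
Proof. by case: p_prime => -[_ _ _ pM] _ _ _ /integersP; apply: pM. Qed.

Lemma primeMr a x : a \in integers_pred K -> p x -> p (x * a).
Proof. by rewrite mulrC; apply: primeMl. Qed.

Lemma primeN x : p x -> p (- x).
Proof. by rewrite -mulN1r; apply: primeMl; rewrite rpredN rpred1. Qed.

Lemma primeB x y : p x -> p y -> p (x - y).
Proof. by move=> px /primeN; apply: primeD. Qed.

Lemma primeDr x y : p (x + y) -> p x -> p y.
Proof. by move=> pxy px; rewrite -[y](addKr x) addrC; apply: primeB. Qed.

Lemma prime_mul x y : x \in integers_pred K -> y \in integers_pred K ->
  p (x * y) -> p x \/ p y.
Proof.
by case: p_prime => _ _ _ pM /integersP Ox /integersP Oy; apply: pM.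
Qed.

Lemma prime_prod (I : eqType) (r : seq I) (F : I -> K) :
    (forall i, i \in r -> F i \in integers_pred K) ->
  p (\prod_(i <- r) F i) -> exists2 i, i \in r & p (F i).
Proof.
elim: r => [|i r IHr] OF; first by rewrite big_nil => /prime1.
rewrite big_cons => /prime_mul[]; first by apply: OF; rewrite mem_head.
- by rewrite big_seq rpred_prod // => k kr; apply: OF; rewrite in_cons kr orbT.
- by exists i => //; rewrite mem_head.
- case/IHr=> [k kr|k kr pk]; first by apply: OF; rewrite in_cons kr orbT.
  by exists k => //; rewrite in_cons kr orbT.
Qed.

Lemma primeX x n : x \in integers_pred K -> p (x ^+ n) -> p x.
Proof.
move=> Ox; elim: n => [/prime1 //|n IHn].
by rewrite exprS => /prime_mul[]; rewrite ?rpredX.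
Qed.

Lemma prime_sum (I : eqType) (r : seq I) (F : I -> K) :
  (forall i, i \in r -> p (F i)) -> p (\sum_(i <- r) F i).
Proof.
move=> pF; rewrite big_seq; elim/big_ind: _ => //; first exact: prime0.
exact: primeD.
Qed.

(** The first power in [ideal_exp] is the product of [p] with the ring of integers, which is [p]
    again. *)
Lemma prime_valuation0 x : has_valuation p x 0 <-> x \in integers_pred K /\ ~ p x.
Proof.
split=> [[Ox npx]|[/integersP Ox npx]].
  split; first exact/integersP.
  move=> px; apply: npx; exists [:: (x, 1)]; last by rewrite big_seq1 mulr1.
  by move=> ab; rewrite inE => /eqP ->; split=> //; apply/integersP/rpred1.
split=> // -[s ps xE]; apply: npx; rewrite xE.
by apply: prime_sum => ab /ps [pa /integersP Ob]; apply: primeMr.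
Qed.

Lemma prime_nat_dvd l m : prime l -> p l%:R -> p m%:R -> (l %| m)%N.
Proof.
move=> l_prime pl pm; apply: contraT; rewrite -prime_coprime // => /eqP lm1.
case: prime1; case: (egcdnP m (prime_gt0 l_prime)) => km kn kE _.
have: p (km * l)%:R by rewrite natrM; apply: primeMl; rewrite // rpred_nat.
rewrite kE natrD lm1 => /primeDr; apply.
by rewrite natrM; apply: primeMl; rewrite // rpred_nat.
Qed.

Lemma prime_absz (c : int) : p c%:~R <-> p `|c|%N%:R.
Proof.
have cE : `|c|%N%:R = `|c|%:~R :> K by [].
rewrite cE; have [_|_] := ger0P c; first by [].
rewrite rmorphN /=; split=> [/primeN //|/primeN].
by rewrite opprK.
Qed.

Lemma prime_int_dvd l (c : int) : prime l -> p l%:R -> p c%:~R -> (l %| `|c|)%N.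
Proof. by move=> l_prime pl /prime_absz; apply: prime_nat_dvd. Qed.

(** A nonzero [x] in [p] satisfies a monic integral equation. Divided by a power of [x], it has a
    nonzero constant term, a multiple of [x] and so in [p]; some prime factor of this integer is in
    [p]. *)
Lemma prime_rational : exists2 l, prime l & p l%:R.
Proof.
have [x px x0] : exists2 x, p x & x != 0 by case: p_prime.
have /integersP[q q_monic rqx] := prime_integer px.
have [m m0 pm] : exists2 m, (0 < m)%N & p m%:R.
  elim/poly_ind: q q_monic rqx => [|q c IHq] q_monic.
    by rewrite monicE lead_coef0 eq_sym oner_eq0 in q_monic.
  have [q0|q0] := eqVneq q 0.
    move: q_monic; rewrite q0 mul0r add0r monicE lead_coefC => /eqP ->.
    by rewrite rmorph1 rootE hornerC oner_eq0.
  have q1 : q \is monic.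
    move: q_monic; rewrite !monicE lead_coefDl ?lead_coefMX //.
    by rewrite size_mulX // size_polyC; case: (c == 0); rewrite // ltnS size_poly_gt0.
  rewrite rootE rmorphD rmorphM /= map_polyX map_polyC hornerD hornerMX hornerC.
  have [->|c0] := eqVneq c 0.
    by rewrite addr0 mulf_eq0 (negPf x0) orbF; apply: IHq.
  rewrite addr_eq0 => /eqP qE; exists `|c|%N; first by rewrite absz_gt0.
  apply/prime_absz; rewrite -[c%:~R]opprK -qE; apply/primeN/primeMl => //.
  apply: rpred_horner; last exact: prime_integer.
  by apply/polyOverP => i; rewrite coef_map rpred_int.
rewrite (prod_prime_decomp m0) natr_prod in pm.
case/prime_prod: pm => [i _|[l e] /mem_prime_decomp[l_prime _ _] /=].
  by rewrite rpred_nat.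
by rewrite natrX => pl; exists l => //; apply: primeX pl; rewrite rpred_nat.
Qed.

End PrimeIdeals.

(** For [a] in [p] but not in [q], take a monic integer polynomial vanishing at [a]. An integer in
    [p] is divisible by the rational prime [l] in [q], hence lies in [q]; so the constant term is in
    [q], a factor [a] cancels modulo [q], and descent on the degree ends with 1 in [q]. *)
Lemma prime_maximal (K : fieldExtType rat) (p q : set K) :
  is_prime p -> is_prime q -> (q `<=` p -> q = p)%classic.
Proof.
move=> p_prime q_prime qp; apply/seteqP; split=> // a pa.
apply: contrapT => nqa; have Oa := prime_integer p_prime pa.
have [l l_prime ql] := prime_rational q_prime.
have /integersP[P P_monic /eqP Pa] := Oa.
have {Pa} : q (map_poly intr P).[a] by rewrite Pa; apply: prime0.
elim/poly_ind: P P_monic => [|P c IHP] P_monic.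
  by rewrite monicE lead_coef0 eq_sym oner_eq0 in P_monic.
have [P0|P0] := eqVneq P 0.
  move: P_monic; rewrite P0 mul0r add0r monicE lead_coefC => /eqP ->.
  by rewrite rmorph1 hornerC; apply: prime1.
have P1 : P \is monic.
  move: P_monic; rewrite !monicE lead_coefDl ?lead_coefMX //.
  by rewrite size_mulX // size_polyC; case: (c == 0); rewrite // ltnS size_poly_gt0.
rewrite rmorphD rmorphM /= map_polyX map_polyC hornerD hornerMX hornerC /= => qPc.
have OP : (map_poly intr P).[a] \in integers_pred K.
  by apply: rpred_horner => //; apply/polyOverP => i; rewrite coef_map rpred_int.
have [qc|nqc] := pselect (q c%:~R).
  have: q ((map_poly intr P).[a] * a).
    by move: qPc; rewrite addrC => /(primeDr q_prime); apply.
  by case/(prime_mul q_prime) => //; apply: IHP.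
apply: nqc; have pc : p c%:~R.
  by apply: (primeDr p_prime (qp _ qPc)); apply: (primeMl p_prime).
have /dvdnP[m cE] := prime_int_dvd p_prime l_prime (qp _ ql) pc.
by apply/(prime_absz q_prime); rewrite cE natrM; apply: primeMl; rewrite ?rpred_nat.
Qed.

(** * The number of primes above a rational prime *)

Section PrimesAbove.
Variables (K : fieldExtType rat) (l : nat).
Hypothesis l_prime : prime l.

Section Independence.
Variables (m : nat) (P : 'I_m -> set K).
Hypotheses (P_prime : forall i, is_prime (P i)) (Pl : forall i, P i l%:R).

(** By maximality each other [P k] has an element outside [P i]; their product works. *)
Lemma primes_separation i : injective P ->
  exists x, [/\ x \in integers_pred K, ~ P i x & forall k, k != i -> P k x].
Proof.
move=> P_inj.
have /choice[x xP] k : exists x, [/\ x \in integers_pred K, ~ P i x & k != i -> P k x].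
  have [->|ki] := eqVneq k i; first by exists 1; split; rewrite ?rpred1 //; apply: prime1.
  have [x Pkx nPix] : exists2 x, P k x & ~ P i x.
    apply: contrapT => nx; case/eqP: ki; apply: P_inj.
    apply: (prime_maximal (P_prime i)) => // x Pkx.
    by apply: contrapT => nPix; apply: nx; exists x.
  by exists x; split=> //; apply: prime_integer Pkx.
exists (\prod_k x k); split=> [|/(prime_prod (P_prime i))[k _|k _]|k ki].
- by rewrite rpred_prod // => k _; case: (xP k).
- by case: (xP k).
- by case: (xP k).
- rewrite (bigD1 k) //=; apply: primeMr => //; last by case: (xP k) => _ _; apply.
  by rewrite rpred_prod // => h _; case: (xP h).
Qed.

Variable e : 'I_m -> K.
Hypothesis eP :
  forall i, [/\ e i \in integers_pred K, ~ P i (e i) & forall k, k != i -> P k (e i)].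

(* An integral relation has all its coefficients divisible by [l]; descend. *)
Lemma separators_independent (c : 'I_m -> int) :
  \sum_i (c i)%:~R * e i = 0 -> forall i, c i = 0.
Proof.
have [B] := ubnP (\sum_i `|c i|)%N; elim: B c => // B IHB c cB c0.
(* Modulo [P i] only the [i]-th term of the relation survives, and [e i] is nonzero there. *)
have lc i : (l %| `|c i|)%N.
  apply: (prime_int_dvd (P_prime i) l_prime (Pl i)).
  case: (eP i) => Oe nPe _.
  have [] // := prime_mul (P_prime i) (x := (c i)%:~R) _ Oe; first by rewrite rpred_int.
  move: c0; rewrite (bigD1 i) //= => /eqP; rewrite addr_eq0 => /eqP ->.
  apply: primeN => //; rewrite -big_filter; apply: prime_sum => // k.
  rewrite mem_filter => /andP[ki _]; apply: primeMl; rewrite ?rpred_int //.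
  by case: (eP k) => _ _; apply; rewrite eq_sym.
have cE i : c i = l%:Z * (c i %/ l%:Z)%Z by rewrite mulrC divzK // dvdzE.
have [z|c'0] := posnP (\sum_i `|(c i %/ l%:Z)%Z|)%N.
  move=> i; rewrite cE.
  have := leq0n 0; rewrite -{1}z (bigD1 i) //= leqn0 addn_eq0 absz_eq0.
  by case/andP=> /eqP -> _; rewrite mulr0.
have c'0E : \sum_i (c i %/ l%:Z)%Z%:~R * e i = 0.
  apply: (@mulfI _ l%:R).
    rewrite -(rmorph_nat (in_alg K)) fmorph_eq0 pnatr_eq0.
    by case: l l_prime.
  rewrite mulr0 -[RHS]c0 mulr_sumr; apply: eq_bigr => i _.
  by rewrite [in RHS]cE intrM mulrA.
move=> i; rewrite cE (IHB (fun k => (c k %/ l%:Z)%Z)) ?mulr0 //.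
apply: (@leq_trans (\sum_i `|c i|)%N); last by [].
have -> : (\sum_i `|c i| = l * \sum_i `|(c i %/ l%:Z)%Z|)%N.
  by rewrite big_distrr; apply: eq_bigr => k _; rewrite [in LHS]cE abszM.
by rewrite ltn_Pmull // prime_gt1.
Qed.

Lemma primes_above_bound_aux : (m <= \dim {:K})%N.
Proof.
suff /eqP fe : free [tuple e i | i < m].
  by rewrite -[m](size_tuple [tuple e i | i < m]) -fe dimvS ?subvf.
apply/freeP => k k0 i.
(* Clearing denominators: [c i] is the integer [D * k i]. *)
pose D := (\prod_j denq (k j))%R.
pose c i : int := numq (k i) * \prod_(j | j != i) denq (k j).
have cE h : (c h)%:~R = D%:~R * k h :> rat.
  by rewrite /c /D [in RHS](bigD1 h) //= !intrM numqE; ring.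
have c0 h : c h = 0.
  apply: separators_independent h.
  transitivity (D%:~R *: (\sum_(i < m) k i *: [tuple e i | i < m]`_i)); last by rewrite k0 scaler0.
  rewrite scaler_sumr; apply: eq_bigr => h _; rewrite scalerA -cE.
  by rewrite scaler_int mulrzl -tnth_nth tnth_mktuple.
have /eqP : D%:~R * k i = 0 by rewrite -cE c0.
rewrite mulf_eq0 intr_eq0 => /orP[/prodf_eq0[h _]|/eqP //].
by rewrite (negPf (denq_neq0 _)).
Qed.

End Independence.

Lemma primes_above_bound m (P : 'I_m -> set K) : injective P ->
    (forall i, is_prime (P i)) -> (forall i, P i l%:R) ->
  (m <= \dim {:K})%N.
Proof.
move=> P_inj P_prime Pl.
have /choice[e eP] i := primes_separation P_prime i P_inj.
exact: primes_above_bound_aux P_prime Pl e eP.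
Qed.

(** Duplicate-free lists of primes above [l] have bounded length; a longest one contains them
    all. *)
Lemma primes_above_finite : exists2 s : seq (set K), (size s <= \dim {:K})%N &
  forall p, is_prime p -> p l%:R -> p \in s.
Proof.
pose A m := `[< exists s : seq (set K), [/\ size s = m, uniq s &
  forall p, p \in s -> is_prime p /\ p l%:R] >].
have A0 : exists m, A m by exists 0; apply/asboolP; exists [::].
have Abound m : A m -> (m <= \dim {:K})%N.
  move=> /asboolP[s [<- s_uniq sP]].
  have sPi (i : 'I_(size s)) := sP _ (mem_nth set0 (ltn_ord i)).
  apply: (@primes_above_bound _ (fun i : 'I_(size s) => nth set0 s i)) => [i k|i|i].
  - by move/eqP; rewrite nth_uniq // => /eqP/val_inj.
  - by case: (sPi i).
  - by case: (sPi i).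
case: (ex_maxnP A0 Abound) => m /asboolP[s [sm s_uniq sP]] mmax.
exists s => [|p p_prime pl]; first by rewrite sm; apply: Abound; apply/asboolP; exists s.
apply: contraT => ps; have := mmax m.+1; rewrite ltnn; apply.
apply/asboolP; exists (p :: s); split; rewrite /= ?sm ?ps //.
by move=> q; rewrite inE => /predU1P[->|/sP].
Qed.

End PrimesAbove.

(** * Isomorphisms of hyperelliptic function fields *)

Section Gauss.
Import Pdiv.Idomain.
Variables (k : closedFieldType) (E : fieldType).
Variables (phi : {rmorphism {poly k} -> E}) (z : E).
Hypothesis phi_inj : injective phi.
Implicit Types F G : {poly {poly k}}.

Lemma sizeYM F G : F != 0 -> G != 0 -> sizeY (F * G) = (sizeY F + sizeY G).-1.
Proof. by move=> F0 G0; rewrite !sizeYE rmorphM size_mul ?swapXY_eq0. Qed.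

Lemma sizeYC (c : {poly k}) : sizeY c%:P = size c.
Proof. by rewrite sizeYE swapXY_polyC size_map_polyC. Qed.

(** The factor theorem for the inner variable, obtained by exchanging the two variables. *)
Lemma eval_coef_eq0 F (a : k) :
  map_poly (horner_eval a) F = 0 -> exists F', F = ('X - a%:P)%:P * F'.
Proof.
rewrite -[F]swapXYK -horner_polyC => /eqP/factor_theorem[Q ->].
exists (swapXY Q); rewrite rmorphM mulrC; congr (_ * _).
by rewrite rmorphB /= swapXY_X swapXY_polyC map_polyC -polyCB.
Qed.

(* Gauss's lemma: a polynomial vanishing at [z], of least degree in the outer
   variable and then of least degree in the inner one, divides every other, so
   that both of its degrees are minimal. *)
Lemma least_bidegree F1 F2 :
    F1 != 0 -> root (map_poly phi F1) z -> F2 != 0 -> root (map_poly phi F2) z ->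
  exists F, [/\ F != 0, root (map_poly phi F) z, (size F <= size F1)%N
              & (sizeY F <= sizeY F2)%N].
Proof.
move=> F1n0 F1z F2n0 F2z.
pose A m := `[< exists F, [/\ F != 0, root (map_poly phi F) z & size F = m] >].
have A0 : exists m, A m by exists (size F1); apply/asboolP; exists F1.
case: (ex_minnP A0) => m /asboolP[F0 [F0n0 F0z F0m]] mmin.
pose B l := `[< exists F, [/\ F != 0, root (map_poly phi F) z, size F = m & sizeY F = l] >].
have B0 : exists l, B l by exists (sizeY F0); apply/asboolP; exists F0.
case: (ex_minnP B0) => l /asboolP[F [Fn0 Fz Fm Fl]] lmin.
exists F; split=> //; first by rewrite Fm; apply: mmin; apply/asboolP; exists F1.
(* The remainder of the pseudo-division also vanishes at [z], with smaller outer degree. *)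
have R0 : F2 %% F = 0.
  apply/eqP/contraT => Rn0.
  have : root (map_poly phi (F2 %% F)) z.
    have := congr1 (fun P => (map_poly phi P).[z]) (divp_eq F2 F).
    rewrite -mul_polyC !rmorphD !rmorphM /= !hornerE (rootP F2z) (rootP Fz).
    by rewrite !mulr0 add0r => /esym/eqP.
  move=> Rz; have := ltn_modp F2 F; rewrite Fn0 ltnNge Fm mmin //.
  by apply/asboolP; exists (F2 %% F).
have [c [H [cn0 cF2]]] : exists c H, c != 0 /\ c%:P * F2 = H * F.
  exists (lead_coef F ^+ scalp F2 F), (F2 %/ F).
  by rewrite expf_neq0 ?lead_coef_eq0 // mul_polyC divp_eq R0 addr0.
(* The multiplier [c] of the pseudo-division is cancelled one linear factor at a time. *)
have [s] := ubnP (size c); elim: s c H cn0 cF2 => // s IHs c H cn0 cF2 cs.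
have Hn0 : H != 0.
  apply: contraNneq F2n0 => H0; move/eqP: cF2; rewrite H0 mul0r mulf_eq0.
  by rewrite polyC_eq0 (negPf cn0).
have cF2n0 : c%:P * F2 != 0 by rewrite mulf_neq0 ?polyC_eq0.
have [c1|] := eqVneq (size c) 1%N.
  have := congr1 (@sizeY k) cF2; rewrite !sizeYM ?polyC_eq0 // sizeYC c1 add1n /= => ->.
  have : (0 < sizeY H)%N by rewrite lt0n sizeY_eq0.
  by case: (sizeY H) => // h _; rewrite addSn leq_addl.
move=> /closed_rootP[a ca].
have [c' cE] := factor_theorem _ _ ca.
(* At a root [a] of [c] the specialisations of [H] and [F] have product zero, so ['X - a] divides
   one of the two. *)
have : map_poly (horner_eval a) H * map_poly (horner_eval a) F = 0.
  by rewrite -rmorphM -cF2 rmorphM /= map_polyC /= /horner_eval (rootP ca) mul0r.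
move/eqP; rewrite mulf_eq0 => /orP[] /eqP/eval_coef_eq0[P PE].
  have c'n0 : c' != 0 by apply: contraNneq cn0 => c'0; rewrite cE c'0 mul0r.
  apply: (IHs c' P) => //; last first.
    by move: cs; rewrite cE size_Mmonic ?monicXsubC // size_XsubC addn2.
  apply: (@mulfI _ ('X - a%:P)%:P); first by rewrite polyC_eq0 polyXsubC_eq0.
  by rewrite !mulrA -PE -cF2 cE polyCM [_ * c'%:P]mulrC.
have Pn0 : P != 0 by apply: contraNneq Fn0 => P0; rewrite PE P0 mulr0.
have XaN0 : ('X - a%:P)%:P != 0 :> {poly {poly k}} by rewrite polyC_eq0 polyXsubC_eq0.
(* Dividing [F] by ['X - a] would keep its outer degree and lower the inner one. *)
have : B (sizeY P).
  apply/asboolP; exists P; split=> //.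
    move: Fz; rewrite PE rmorphM /= map_polyC rootM rootC => /orP[|//].
    by rewrite -(rmorph0 phi) (inj_eq phi_inj) polyXsubC_eq0.
  by rewrite -Fm PE mul_polyC size_scale // polyXsubC_eq0.
move/lmin; rewrite -Fl PE sizeYM // sizeYC size_XsubC /=.
by rewrite ltnn.
Qed.

End Gauss.

(** For a bivariate polynomial, [map_poly (eval_at i x)] sends the inner variable to [x]; the outer
    one is evaluated afterwards. *)
Definition eval_at (k E : fieldType) (i : {rmorphism k -> E}) (x : E)
  (p : {poly k}) : E := (map_poly i p).[x].
HB.instance Definition _ k E i x := GRing.RMorphism.copy (@eval_at k E i x)
  (horner_eval x \o map_poly i).

Lemma eval_atX (k E : fieldType) (i : {rmorphism k -> E}) x : eval_at i x 'X = x.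
Proof. by rewrite /eval_at map_polyX hornerX. Qed.

Lemma eval_atC (k E : fieldType) (i : {rmorphism k -> E}) x c :
  eval_at i x c%:P = i c.
Proof. by rewrite /eval_at map_polyC hornerC. Qed.

Lemma eval_at_swapXY (k E : fieldType) (i : {rmorphism k -> E}) x z F :
  (map_poly (eval_at i z) (swapXY F)).[x] = (map_poly (eval_at i x) F).[z].
Proof.
have evalE u v G : (map_poly (eval_at i u) G).[v] =
    (map_poly (map_poly i) G).[v, u].
  rewrite (eq_map_poly (g := horner_eval u \o map_poly i)) // map_poly_comp.
  by rewrite -[v in LHS](hornerC v u) horner_map.
by rewrite !evalE -swapXY_map horner2_swapXY.
Qed.

(* Compare the multiplicities of [e] modulo 2. *)
Lemma odd_root (k : fieldType) (s : seq k) (r d q : {poly k}) e :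
    uniq s -> e \in s -> r != 0 -> q != 0 ->
  r ^+ 2 * d = q ^+ 2 * \prod_(a <- s) ('X - a%:P) -> root d e.
Proof.
move=> s_uniq es rn0 qn0 eq_rq; apply: contraT => nde.
have dn0 : d != 0 by apply: contraNneq nde => ->; apply: root0.
have fn0 : \prod_(a <- s) ('X - a%:P) != 0 by rewrite monic_neq0 // monic_prod_XsubC.
have /(congr1 odd) := congr1 (mup e) eq_rq.
rewrite mupMl // !expr2 !mupM ?mulf_neq0 // !addnn oddD !odd_double.
suff -> : mup e (\prod_(a <- s) ('X - a%:P)) = 1%N by [].
rewrite (bigD1_seq e) //= mupMl; first by rewrite -['X - e%:P]expr1 mup_XsubCX eqxx.
by rewrite -big_filter root_prod_XsubC mem_filter eqxx.
Qed.

(** * Quadratic extensions of a rational function field *)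

Section FunctionField.
Variables (k : fieldType) (E : fieldType) (i : {rmorphism k -> E}).
Hypothesis two_neq0 : 2%:R != 0 :> k.

Lemma eval_at_inj x : ~ algebraicOver i x -> injective (eval_at i x).
Proof.
move=> x_tr; apply: raddf_inj => p px; apply/eqP/contraT => pn0.
by case: x_tr; exists p => //; apply/eqP.
Qed.

Definition rational_in x z :=
  exists p r : {poly k}, r != 0 /\ z = eval_at i x p / eval_at i x r.

Lemma rational_in_poly x u (p : {poly k}) : ~ algebraicOver i x ->
  rational_in x u -> rational_in x (eval_at i u p).
Proof.
move=> x_tr [a [b [bn0 uE]]]; have x_inj := eval_at_inj x_tr.
have nz r : r != 0 -> eval_at i x r != 0.
  by move=> rn0; rewrite -(rmorph0 (eval_at i x)) (inj_eq x_inj).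
elim/poly_ind: p => [|p c [p' [r [rn0 pE]]]].
  by exists 0, 1; rewrite oner_neq0 !rmorph0 mul0r.
exists (p' * a + c *: (r * b)), (r * b); split; first by rewrite mulf_neq0.
rewrite rmorphD rmorphM /= eval_atX eval_atC pE uE -mul_polyC !rmorphD !rmorphM /= eval_atC.
by field; rewrite !nz.
Qed.

Lemma rational_in_div x u v : rational_in x u -> rational_in x v -> v != 0 ->
  rational_in x (u / v).
Proof.
move=> [a [b [bn0 uE]]] [c [d [dn0 vE]]] vn0.
have cn0 : c != 0 by apply: contraNneq vn0 => c0; rewrite vE c0 rmorph0 mul0r.
exists (a * d), (b * c); split; first by rewrite mulf_neq0.
by rewrite uE vE !rmorphM /= !invfM invrK; ring.
Qed.

Variables (s : seq k) (x y : E).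
Hypotheses (s_uniq : uniq s) (s_neq0 : (0 < size s)%N).
Local Notation f := (\prod_(e <- s) ('X - e%:P)).
Hypothesis xy : generic_point i (Weq 0 f) x y.
Local Notation phi := (eval_at i x).

Lemma generic_transcendental : ~ algebraicOver i x.
Proof. by case: xy. Qed.

Let phi_inj := eval_at_inj generic_transcendental.

Lemma generic_eq0 p : (phi p == 0) = (p == 0).
Proof. by rewrite -(rmorph0 phi) (inj_eq phi_inj). Qed.

Lemma generic_square : y ^+ 2 = phi f.
Proof. by case: xy => _; rewrite /on_curve /= rmorph0 horner0 mul0r addr0. Qed.

Lemma generic_basis z : exists p q r : {poly k}, r != 0 /\ z = (phi p + phi q * y) / phi r.
Proof. by case: xy => _ _; apply. Qed.

Lemma prodXsubC_neq0 : f != 0.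
Proof. by rewrite monic_neq0 // monic_prod_XsubC. Qed.

(** If [y = p / r] then [p^2 = r^2 f], and [odd_root] with [d = 1] would give the constant 1 a
    root. *)
Lemma generic_irrational : ~ rational_in x y.
Proof.
move=> [p [r [rn0 yE]]].
have eq_rp : p ^+ 2 * 1 = r ^+ 2 * f.
  apply: phi_inj; rewrite mulr1 [RHS]rmorphM /= -generic_square yE !rmorphXn /= exprMn exprVn.
  by rewrite mulrC divfK // expf_eq0 /= generic_eq0.
have pn0 : p != 0.
  apply: contraNneq (mulf_neq0 (expf_neq0 2 rn0) prodXsubC_neq0) => p0.
  by rewrite -eq_rp p0 expr0n mul0r.
have es : nth 0 s 0 \in s by apply: mem_nth.
by have := odd_root s_uniq es pn0 rn0 eq_rp; rewrite rootC oner_eq0.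
Qed.

Lemma generic_independent a b : phi a + phi b * y = 0 -> a = 0 /\ b = 0.
Proof.
move=> ab0; have [b0|bn0] := eqVneq b 0.
  by move/eqP: ab0; rewrite b0 rmorph0 mul0r addr0 generic_eq0 => /eqP.
case: generic_irrational; exists (- a), b; split=> //.
apply: (mulIf (_ : phi b != 0)); rewrite ?generic_eq0 // divfK ?generic_eq0 //.
by rewrite rmorphN mulrC; apply/eqP; rewrite -addr_eq0 addrC ab0.
Qed.

Lemma size_linear (r p : {poly k}) :
  r != 0 -> size (r%:P * 'X - p%:P) = 2.
Proof. by move=> rn0; rewrite -polyCN size_MXaddC polyC_eq0 (negPf rn0) /= size_polyC rn0. Qed.

(** With [z = (p + q y) / r], the equation is [(r z - p)^2 = q^2 f]. *)
Lemma generic_quadratic z :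
  exists F : {poly {poly k}}, [/\ F != 0, root (map_poly phi F) z & (size F <= 3)%N].
Proof.
have [p [q [r [rn0 zE]]]] := generic_basis z.
pose G := r%:P * 'X - p%:P.
have sG2 : size (G ^+ 2) = 3.
  have := size_exp G 2; rewrite size_linear //= mul1n.
  by case: (size (G ^+ 2)) => //= n ->.
have sF : size (G ^+ 2 - (q ^+ 2 * f)%:P) = 3.
  rewrite size_polyDl sG2 // size_polyN size_polyC.
  by case: (_ == 0).
exists (G ^+ 2 - (q ^+ 2 * f)%:P); split; rewrite ?sF //; first by rewrite -size_poly_eq0 sF.
rewrite rootE rmorphB rmorphXn /= map_polyC /= rmorphM rmorphXn /= -generic_square.
rewrite rmorphB rmorphM /= !map_polyC map_polyX !hornerE /= zE mulrC divfK ?generic_eq0 //.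
by rewrite [phi p + _]addrC addrK exprMn -mulrA -expr2 subrr.
Qed.

Lemma rational_linear z : rational_in x z ->
  exists F : {poly {poly k}}, [/\ F != 0, root (map_poly phi F) z & (size F <= 2)%N].
Proof.
move=> [p [r [rn0 zE]]]; exists (r%:P * 'X - p%:P).
split; rewrite -?size_poly_eq0 ?size_linear // rootE rmorphB rmorphM /= !map_polyC map_polyX.
by rewrite !hornerE /= zE mulrC divfK ?subrr // generic_eq0.
Qed.

(* Otherwise the discriminant in [z], of degree at most 4, vanishes on [s]. *)
Lemma small_bidegree_rational (F : {poly {poly k}}) z :
    F != 0 -> root (map_poly phi F) z -> (size F <= 3)%N -> (sizeY F <= 3)%N ->
    (5 <= size s)%N -> rational_in x z.
Proof.
move=> Fn0 Fz sF sYF s5; have [p [q [r [rn0 zE]]]] := generic_basis z.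
have [q0|qn0] := eqVneq q 0; first by exists p, r; rewrite zE q0 rmorph0 mul0r addr0.
have FE : F = F`_2 *: 'X^2 + F`_1 *: 'X + (F`_0)%:P.
  apply/polyP => n; rewrite !coefE.
  case: n => [|[|[|n]]]; rewrite /= ?mulr0 ?mulr1 ?addr0 ?add0r //.
  by rewrite nth_default // (leq_trans sF).
have sFn n : (size (F`_n)%R <= 3)%N := leq_trans (@max_size_coefXY _ F n) sYF.
move: F`_2 F`_1 F`_0 FE (sFn 2%N) (sFn 1%N) (sFn 0%N) => a b c FE sa sb sc.
have r0 : phi r != 0 by rewrite generic_eq0.
(* Substituting [z = (p + q y) / r] in [a z^2 + b z + c = 0] and multiplying by [r^2], the parts in
   1 and in [y] vanish separately. *)
have : phi (a * (p ^+ 2 + q ^+ 2 * f) + b * p * r + c * r ^+ 2)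
         + phi (q * (2%:R * a * p + b * r)) * y = 0.
  have := rootP Fz; rewrite FE -!mul_polyC !(rmorphD, rmorphM, rmorphXn) /=.
  rewrite !map_polyC map_polyX !hornerE /= => Fz0.
  have := congr1 (fun u => u * phi r ^+ 2) Fz0; rewrite mul0r => <-.
  rewrite zE !rmorph1 -!generic_square.
  by field.
case/generic_independent => eq0 /eqP; rewrite mulf_eq0 (negPf qn0) /= => /eqP eq1.
(* Eliminating [p] shows that the discriminant equals [f] up to squares, so it vanishes at the roots
   of [f]. *)
have eq_d : r ^+ 2 * (b ^+ 2 - 4%:R * a * c) = (2%:R * a * q) ^+ 2 * f.
  have -> : r ^+ 2 * (b ^+ 2 - 4%:R * a * c) = (2%:R * a * q) ^+ 2 * f +
     (2%:R * a * p + b * r) ^+ 2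
     - 4%:R * a * (a * (p ^+ 2 + q ^+ 2 * f) + b * p * r + c * r ^+ 2) by ring.
  by rewrite eq0 eq1 expr0n mulr0 subr0 addr0.
have two_poly : 2%:R != 0 :> {poly k} by rewrite -polyC_natr polyC_eq0.
(* If [a] vanished, so would [b] and then [c]. *)
have an0 : a != 0.
  apply: contraNneq Fn0 => a0; move: eq0 eq1; rewrite FE a0 !(mulr0, mul0r, add0r).
  move=> + /eqP; rewrite mulf_eq0 (negPf rn0) orbF => + /eqP b0.
  rewrite b0 !mul0r add0r => /eqP; rewrite mulf_eq0 expf_eq0 (negPf rn0) orbF => /eqP ->.
  by rewrite !scale0r !addr0.
have aq0 : 2%:R * a * q != 0 by rewrite !mulf_neq0.
have dn0 : b ^+ 2 - 4%:R * a * c != 0.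
  apply: contraTneq (mulf_neq0 (expf_neq0 2 aq0) prodXsubC_neq0) => d0.
  by rewrite -eq_d d0 mulr0 eqxx.
have sd : (size (b ^+ 2 - 4%:R * a * c)%R <= 5)%N.
  rewrite (leq_trans (size_polyD _ _)) // geq_max size_polyN; apply/andP; split.
    by rewrite expr2 (leq_trans (size_polyMleq _ _)) //; lia.
  rewrite -mulrA -polyC_natr mul_polyC (leq_trans (size_scale_leq _ _)) //.
  apply: leq_trans (size_polyMleq _ _) _.
  by have := leq_add sa sc; case: (_ + _)%N.
have /(leq_ltn_trans s5) : (size s < size (b ^+ 2 - 4%:R * a * c)%R)%N.
  apply: max_poly_roots => //; apply/allP => e es.
  exact: odd_root s_uniq es rn0 aq0 eq_d.
by move/leq_trans/(_ sd).
Qed.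

End FunctionField.

(** * Moebius relation between two generic points of the same field *)

Section Moebius.
Variables (k : closedFieldType) (E : fieldType) (i : {rmorphism k -> E}).
Hypothesis two_neq0 : 2%:R != 0 :> k.
Local Notation ev := (eval_at i).
Local Notation curve s := (Weq 0 (\prod_(e <- s) ('X - e%:P))).

(** [F1] bounds the degree in [x2] and [F2] the degree in [x1]; with the variables of [F2]
    exchanged, both vanish at the same point and [least_bidegree] applies. *)
Lemma exists_small_bidegree x1 x2 m n (F1 F2 : {poly {poly k}}) :
    ~ algebraicOver i x1 ->
    [/\ F1 != 0, root (map_poly (eval_at i x1) F1) x2 & (size F1 <= m)%N] ->
    [/\ F2 != 0, root (map_poly (eval_at i x2) F2) x1 & (size F2 <= n)%N] ->
  exists F : {poly {poly k}}, [/\ F != 0, root (map_poly (eval_at i x1) F) x2,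
    (size F <= m)%N & (sizeY F <= n)%N].
Proof.
move=> x1_tr [F1n0 F1x sF1] [F2n0 F2x sF2].
have [||F [Fn0 Fx sF sYF]] :=
    least_bidegree (eval_at_inj x1_tr) F1n0 F1x (F2 := swapXY F2).
- by rewrite swapXY_eq0.
- by rewrite rootE eval_at_swapXY -rootE.
exists F; split; rewrite ?(leq_trans sF) //.
by rewrite (leq_trans sYF) // sizeYE swapXYK.
Qed.

Lemma generic_rational (s1 s2 : seq k) x1 y1 x2 y2 :
    uniq s1 -> (5 <= size s1)%N -> uniq s2 -> (5 <= size s2)%N ->
    generic_point i (curve s1) x1 y1 -> generic_point i (curve s2) x2 y2 ->
  rational_in i x1 x2.
Proof.
move=> us1 s1_5 us2 s2_5 xy1 xy2.
have s1_0 : (0 < size s1)%N by apply: leq_trans s1_5.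
have s2_0 : (0 < size s2)%N by apply: leq_trans s2_5.
have [F1 F1P] := generic_quadratic xy1 x2.
have [F2 F2P] := generic_quadratic xy2 x1.
have [F [Fn0 Fx sF sYF]] :=
  exists_small_bidegree (generic_transcendental xy1) F1P F2P.
exact: (small_bidegree_rational two_neq0 us1 s1_0 xy1 Fn0 Fx sF sYF s1_5).
Qed.

(** Each of [x1] and [x2] is rational in the other, so the least bidegree is at most (1, 1), and the
    relation can be solved for [x2]. *)
Lemma generic_moebius (s1 s2 : seq k) x1 y1 x2 y2 :
    uniq s1 -> (5 <= size s1)%N -> uniq s2 -> (5 <= size s2)%N ->
    generic_point i (curve s1) x1 y1 -> generic_point i (curve s2) x2 y2 ->
  exists a b c d : k, a * d - b * c != 0 /\ i c + i d * x1 != 0 /\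
    x2 * (i c + i d * x1) = i a + i b * x1.
Proof.
move=> us1 s1_5 us2 s2_5 xy1 xy2.
have [F1 F1P] := rational_linear xy1 (generic_rational us1 s1_5 us2 s2_5 xy1 xy2).
have [F2 F2P] := rational_linear xy2 (generic_rational us2 s2_5 us1 s1_5 xy2 xy1).
have x1_tr := generic_transcendental xy1; have x2_tr := generic_transcendental xy2.
have [F [Fn0 Fx sF sYF]] := exists_small_bidegree x1_tr F1P F2P.
have x2_ncst (u v : k) : v != 0 -> x2 * i v = i u -> False.
  move=> vn0 x2E; apply: x2_tr; have -> : x2 = i (u / v).
    by rewrite fmorph_div /= -x2E mulfK // fmorph_eq0.
  exact: algebraic_id.
have FE : F = F`_1 *: 'X + (F`_0)%:P.
  apply/polyP => n; rewrite !coefE.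
  case: n => [|[|n]]; rewrite /= ?mulr0 ?mulr1 ?addr0 ?add0r //.
  by rewrite nth_default // (leq_trans sF).
have linE (p : {poly k}) : (size p <= 2)%N -> p = p`_1 *: 'X + (p`_0)%:P.
  move=> sp; apply/polyP => n; rewrite !coefE.
  case: n => [|[|n]]; rewrite /= ?mulr0 ?mulr1 ?addr0 ?add0r //.
  by rewrite nth_default // (leq_trans sp).
have sFn n : (size (F`_n)%R <= 2)%N := leq_trans (max_size_coefXY F n) sYF.
move: F`_1 F`_0 FE (linE _ (sFn 1%N)) (linE _ (sFn 0%N)) => p q FE pE qE.
move: p`_1 p`_0 q`_1 q`_0 pE qE => d c b a pE qE.
have eqx : x2 * (i c + i d * x1) = i (- a) + i (- b) * x1.
  have := rootP Fx; rewrite FE -mul_polyC !(rmorphD, rmorphM) /= !map_polyC map_polyX.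
  rewrite !hornerE /= pE qE -!mul_polyC !(rmorphD, rmorphM) /= !eval_atC eval_atX.
  by move=> eq0; apply/eqP; rewrite -subr_eq0 -eq0 !rmorphN; apply/eqP; ring.
have pn0 : p != 0.
  apply: contraNneq Fn0 => p0; have := rootP Fx; rewrite FE p0 scale0r add0r.
  rewrite map_polyC hornerC => /eqP; rewrite -(rmorph0 (eval_at i x1)).
  by rewrite (inj_eq (eval_at_inj x1_tr)) => /eqP ->.
have cdx : i c + i d * x1 = eval_at i x1 p.
  by rewrite pE -mul_polyC rmorphD rmorphM /= !eval_atC eval_atX addrC.
have cd0 : i c + i d * x1 != 0.
  by rewrite cdx -(rmorph0 (eval_at i x1)) (inj_eq (eval_at_inj x1_tr)).
exists (- a), (- b), c, d; split=> //.
(* With a zero determinant, numerator and denominator are proportional and the transcendental [x2]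
   would be a constant. *)
apply/eqP => det0.
have [d0|dn0] := eqVneq d 0.
  have cn0 : c != 0.
    by apply: contraNneq cd0 => ->; rewrite d0 rmorph0 mul0r addr0.
  move/eqP: det0; rewrite d0 mulr0 sub0r mulNr opprK mulf_eq0 (negPf cn0) orbF => /eqP b0.
  apply: (x2_ncst (- a) c cn0).
  by move: eqx; rewrite d0 b0 oppr0 rmorph0 !mul0r !addr0.
apply: (x2_ncst (- b) d dn0); apply: (mulIf cd0).
have ad : i a * i d = i b * i c.
  apply/eqP; rewrite -subr_eq0 -!rmorphM -rmorphB -(rmorph0 i); apply/eqP; congr (i _).
  by rewrite -[RHS]oppr0 -det0; ring.
rewrite mulrAC eqx; apply/eqP; rewrite -subr_eq0 !rmorphN.
rewrite [X in X == 0](_ : _ = i b * i c - i a * i d); first by rewrite ad subrr.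
ring.
Qed.

(* [y2 ^ 2] and [y1 ^ 2] agree up to squares of [k(x1)], hence have the same
   branch points. *)
Lemma generic_branch_points (s1 s2 : seq k) x1 y1 x2 y2 :
    uniq s1 -> (5 <= size s1)%N -> uniq s2 -> (5 <= size s2)%N -> odd (size s2) ->
    generic_point i (curve s1) x1 y1 -> generic_point i (curve s2) x2 y2 ->
  exists a b c d : k, a * d - b * c != 0 /\ forall e, e \in s1 ->
    c + d * e = 0 \/ exists2 e', e' \in s2 & a + b * e = e' * (c + d * e).
Proof.
move=> us1 s1_5 us2 s2_5 s2_odd xy1 xy2.
have s1_0 : (0 < size s1)%N by apply: leq_trans s1_5.
have s2_0 : (0 < size s2)%N by apply: leq_trans s2_5.
have [a [b [c [d [det [cd0 eqx]]]]]] := generic_moebius us1 s1_5 us2 s2_5 xy1 xy2.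
exists a, b, c, d; split=> // e es1.
have x1_tr := generic_transcendental xy1.
have [p pE] : exists p, p = c%:P + d%:P * 'X by eexists.
have [q qE] : exists q, q = a%:P + b%:P * 'X by eexists.
have phip : ev x1 p = i c + i d * x1 by rewrite pE rmorphD rmorphM /= !eval_atC eval_atX.
have phiq : ev x1 q = i a + i b * x1 by rewrite qE rmorphD rmorphM /= !eval_atC eval_atX.
(* Since [x2 = q / p] at [x1], this is the second polynomial at [x2], cleared of its denominator. *)
pose h := \prod_(e' <- s2) (q - e'%:P * p).
have hE : y2 ^+ 2 * ev x1 p ^+ size s2 = ev x1 h.
  rewrite (generic_square xy2) /h !rmorph_prod /= .
  transitivity (\prod_(e' <- s2) ((x2 - i e') * ev x1 p)).
    rewrite big_split /= big_const_seq count_predT iter_mulr_1.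
    by congr (_ * _); apply: eq_bigr => e' _; rewrite rmorphB /= eval_atX eval_atC.
  apply: eq_bigr => e' _.
  by rewrite rmorphB rmorphM /= eval_atC phiq -eqx -phip mulrBl.
have [u [v [r [rn0 y2E]]]] := generic_basis xy1 y2.
(* The degree is odd, so one more factor [p] makes the power of [p] a square; the root of this extra
   factor is the point sent to infinity. *)
have n2 : size s2 = ((size s2)./2.*2).+1 by rewrite -[LHS]odd_double_half s2_odd.
set m := (size s2)./2 in n2.
have pn0 : p != 0 by rewrite -(generic_eq0 xy1) phip.
have rn0' : ev x1 r != 0 by rewrite (generic_eq0 xy1).
set f1 := \prod_(e <- s1) ('X - e%:P).
(* The square of [y2 = (u + v y1) / r] is compared with [hE]; the part in [y1] forces [u = 0] or
   [v = 0]. *)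
have : ev x1 ((u ^+ 2 + v ^+ 2 * f1) * (p ^+ m.+1) ^+ 2 - r ^+ 2 * (h * p))
    + ev x1 (2%:R * u * v * (p ^+ m.+1) ^+ 2) * y1 = 0.
  have pm : ev x1 p ^+ m.+1 * ev x1 p ^+ m.+1 = ev x1 p ^+ size s2 * ev x1 p.
    by rewrite -exprD n2 -exprSr; congr (_ ^+ _); lia.
  rewrite !(rmorphB, rmorphD, rmorphM, rmorphXn) /=.
  rewrite -hE y2E -(generic_square xy1) pm rmorph1.
  by field.
case/(generic_independent us1 s1_0 xy1) => eq0 /eqP.
have two_poly : 2%:R != 0 :> {poly k} by rewrite -polyC_natr polyC_eq0.
rewrite !mulf_eq0 !expf_eq0 (negPf pn0) (negPf two_poly) /= orbF => /orP[] /eqP uv0.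
  have vn0 : v != 0.
    apply: contraTneq isT => v0; exfalso.
    have y20 : y2 = 0 by rewrite y2E uv0 v0 !rmorph0 mul0r add0r mul0r.
    by case: (generic_irrational us2 s2_0 xy2); exists 0, 1; rewrite oner_neq0 y20 rmorph0 mul0r.
  move/eqP: eq0; rewrite uv0 expr0n add0r subr_eq0 mulrAC -exprMn => /eqP/esym eq0.
  have := odd_root us1 es1 rn0 (mulf_neq0 vn0 (expf_neq0 m.+1 pn0)) eq0.
  rewrite rootM => /orP[]; last by rewrite rootE pE !hornerE => /eqP; left.
  rewrite /h rootE horner_prod prodf_seq_eq0 => /hasP[e' es2 /= /eqP qp].
  right; exists e' => //; apply/eqP; rewrite -subr_eq0 -qp pE qE !hornerE.
  by apply/eqP; ring.
(* Here [v = 0], so [y2] would be rational in [x1], hence in [x2]. *)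
case: (generic_irrational us2 s2_0 xy2).
have x12 := generic_rational us2 s2_5 us1 s1_5 xy2 xy1.
have x2_tr := generic_transcendental xy2.
rewrite y2E uv0 rmorph0 mul0r addr0.
apply: rational_in_div; [exact: rational_in_poly..|by rewrite (generic_eq0 xy1)].
Qed.

End Moebius.

(** * The function field of a hyperelliptic curve *)

Lemma fraction_div (R : idomainType) (a : {fraction R}) :
  exists n d : R, d != 0 /\ a = tofrac n / tofrac d.
Proof.
elim/quotW: a => x; exists \n_x, \d_x; have dx := denom_ratioP x; split=> //.
have dx' : tofrac \d_x != 0 by rewrite tofrac_eq0.
apply: (mulIf dx'); rewrite divfK //; unlock FracField.tofrac.
rewrite -[LHS]FracField.pi_mul; apply/eqmodP; rewrite /= FracField.equivfE /FracField.mulf.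
by rewrite !numden_Ratio ?(oner_eq0, mulf_neq0) // !mulr1 mulrC.
Qed.

(* The fraction field is kept abstract: unification unfolds its operations. *)
Lemma isomorphic_refl_aux (k F : fieldType) (tau : {rmorphism {poly k} -> F})
    (s : seq k) :
    injective tau -> (forall a, exists n d, d != 0 /\ a = tau n / tau d) ->
    uniq s -> (0 < size s)%N ->
  isomorphic (Weq 0 (\prod_(e <- s) ('X - e%:P))) (Weq 0 (\prod_(e <- s) ('X - e%:P))).
Proof.
move=> tau_inj tau_div us s0; set f := \prod_(e <- s) ('X - e%:P).
have tau_eq0 p : (tau p == 0) = (p == 0) by rewrite -(rmorph0 tau) (inj_eq tau_inj).
have fn0 : f != 0 by rewrite monic_neq0 // monic_prod_XsubC.
pose P : {poly F} := 'X^2 - (tau f)%:P.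
have sP : size P = 3%N by rewrite size_XnsubC.
(* In degree 2 it suffices to exclude roots; a root would be a square root of [f] in [k(x)]. *)
have P_irr : irreducible_poly P.
  apply: cubic_irreducible; rewrite ?sP // => u.
  rewrite rootE /P hornerD hornerN hornerXn hornerC; have [a [b [bn0 ->]]] := tau_div u.
  apply/eqP => /eqP; rewrite subr_eq0 => /eqP ab.
  have eq_ab : a ^+ 2 * 1 = b ^+ 2 * f.
    apply: tau_inj; rewrite mulr1 [RHS]rmorphM !rmorphXn /= -ab.
    by rewrite -exprMn mulrC divfK // tau_eq0.
  have an0 : a != 0.
    apply: contraNneq (mulf_neq0 (expf_neq0 2 bn0) fn0) => a0.
    by rewrite -eq_ab a0 expr0n mul0r.
  have es : nth 0 s 0 \in s by apply: mem_nth.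
  by have := odd_root us es an0 bn0 eq_ab; rewrite rootC oner_eq0.
have [L _ [y Py yL]] := irredp_FAdjoin P_irr.
pose ev : {rmorphism {poly k} -> L} := in_alg L \o tau.
have ev_eq0 p : (ev p == 0) = (p == 0) by rewrite /ev /= -[_%:A]/(in_alg L _) fmorph_eq0 tau_eq0.
have ev_div a : exists n d, d != 0 /\ in_alg L a = ev n / ev d.
  by have [n [d [dn0 ->]]] := tau_div a; exists n, d; rewrite fmorph_div.
have y2 : y ^+ 2 = ev f.
  by move: Py; rewrite rootE /P rmorphB /= map_polyXn map_polyC !hornerE subr_eq0 => /eqP.
(* Reduction modulo [P] expresses every polynomial in [y] on the basis 1, [y]. *)
have yq q : exists a b, (map_poly (in_alg L) q).[y] = in_alg L a + in_alg L b * y.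
  exists (q %% P)`_0, (q %% P)`_1.
  rewrite [in LHS](divp_eq q P) rmorphD rmorphM /= hornerD hornerM.
  rewrite (rootP Py) mulr0 add0r.
  have : (size (q %% P)%R < 3)%N by rewrite -sP ltn_modp -size_poly_eq0 sP.
  move: (q %% P) => r sr.
  have {1}-> : r = r`_1 *: 'X + (r`_0)%:P.
    apply/polyP => n; rewrite !coefE.
    case: n => [|[|n]]; rewrite /= ?mulr0 ?mulr1 ?addr0 ?add0r //.
    by rewrite nth_default // -ltnS (leq_trans sr).
  rewrite -mul_polyC rmorphD rmorphM /= !map_polyC map_polyX.
  by rewrite hornerD hornerM hornerX !hornerC addrC.
have : forall z, exists q, z = (map_poly (in_alg L) q).[y].
  by move=> z; apply/Fadjoin1_polyP; rewrite yL memvf.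
move: (in_alg L) ev ev_eq0 ev_div y2 yq => iL ev ev_eq0 ev_div y2 yq Ly {yL}.
pose i : {rmorphism k -> L} := ev \o polyC.
have evE (p : {poly k}) : (map_poly i p).[ev 'X] = ev p.
  elim/poly_ind: p => [|p c IHp]; first by rewrite !rmorph0 horner0.
  by rewrite !rmorphD !rmorphM /= map_polyX map_polyC !hornerE /= IHp.
have xy : generic_point i (Weq 0 f) (ev 'X) y.
  split=> [[p pn0 /rootP/eqP]||z].
  - by rewrite evE ev_eq0 (negPf pn0).
  - by rewrite /on_curve /= rmorph0 horner0 mul0r addr0 evE.
  have [q ->] := Ly z; have [a [b ->]] := yq q.
  have [n [d [dn0 ->]]] := ev_div a; have [n' [d' [d'n0 ->]]] := ev_div b.
  exists (n * d'), (n' * d), (d * d'); split; first by rewrite mulf_neq0.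
  rewrite !evE !rmorphM /=.
  by field; rewrite !ev_eq0 dn0 d'n0.
by exists L, i, (ev 'X), y, (ev 'X), y.
Qed.

(** As [isomorphic] asks for a common function field, reflexivity amounts to constructing
    [k(x)(sqrt f)]. *)
Lemma isomorphic_refl (k : fieldType) (s : seq k) : uniq s -> (0 < size s)%N ->
  isomorphic (Weq 0 (\prod_(e <- s) ('X - e%:P))) (Weq 0 (\prod_(e <- s) ('X - e%:P))).
Proof.
apply: (isomorphic_refl_aux (tau := @tofrac {poly k})) => [p q /eqP|a].
  by rewrite tofrac_eq => /eqP.
exact: fraction_div.
Qed.

(** * Curves with split Weierstrass equations *)

Section Smoothness.
Variables (k : fieldType).
Implicit Types (p : {poly k}) (s : seq k).
Local Notation curve s := (Weq 0 (\prod_(e <- s) ('X - e%:P))).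

Lemma horner_rev_poly m p u : (size p <= m.+1)%N -> u != 0 ->
  (rev_poly m p).[u] = u ^+ m * p.[u^-1].
Proof.
move=> sp u0; rewrite horner_poly (horner_coef_wide _ sp) mulr_sumr.
rewrite (reindex_inj rev_ord_inj) /=; apply: eq_bigr => i _.
have im : (i <= m)%N by rewrite -ltnS.
rewrite subSS subKn // mulrCA; congr (_ * _).
by rewrite exprVn expfB_cond // (negPf u0).
Qed.

(** The operator [u d/du] multiplies the [i]-th term by [i]; in this form, reversing the
    coefficients is a reindexing. *)
Lemma horner_deriv_coef m p u : (size p <= m)%N ->
  u * p^`().[u] = \sum_(i < m) (p`_i *+ i) * u ^+ i.
Proof.
move=> sp; have sXp : (size ('X * p^`())%R <= m)%N.
  rewrite (leq_trans _ sp) //; have [->|p0] := eqVneq p 0; first by rewrite deriv0 mulr0 size_poly0.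
  by rewrite (leq_trans (size_polyMleq _ _)) // size_polyX /= lt_size_deriv.
have -> : u * p^`().[u] = ('X * p^`()).[u] by rewrite hornerM hornerX.
rewrite (horner_coef_wide _ sXp); apply: eq_bigr => i _.
by rewrite coefXM coef_deriv; case: (nat_of_ord i) => // n.
Qed.

Lemma horner_deriv_rev_poly m p u : (size p <= m.+1)%N -> u != 0 ->
  u * (rev_poly m p)^`().[u] = u ^+ m * (p.[u^-1] *+ m - u^-1 * p^`().[u^-1]).
Proof.
move=> sp u0; rewrite (horner_deriv_coef _ (size_poly _ _)).
rewrite (horner_deriv_coef _ sp) (horner_coef_wide _ sp) -sumrMnl -sumrB mulr_sumr.
rewrite (reindex_inj rev_ord_inj) /=; apply: eq_bigr => i _.
have im : (i <= m)%N by rewrite -ltnS.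
rewrite subSS coef_poly ltnS leq_subr subKn // -mulrnAl -mulrBl -mulrnBr //.
rewrite mulrCA; congr (_ * _).
by rewrite exprVn expfB_cond // (negPf u0).
Qed.

Lemma split_simple_root s x :
  uniq s -> root (\prod_(e <- s) ('X - e%:P)) x -> (\prod_(e <- s) ('X - e%:P))^`().[x] != 0.
Proof. by rewrite -separable_prod_XsubC unlock => sep_s; apply: coprimep_root. Qed.

Hypothesis two_neq0 : 2%:R != 0 :> k.

Lemma double_eq0 (y : k) : y *+ 2 = 0 -> y = 0.
Proof. by move/eqP; rewrite -mulr_natl mulf_eq0 (negPf two_neq0) => /eqP. Qed.

Lemma rev_poly0 m : rev_poly m (0 : {poly k}) = 0.
Proof. by apply/polyP => i; rewrite coef_poly !coef0 if_same. Qed.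

(** When 2 is invertible, a singular point has [y = 0] and its abscissa is a multiple root. *)
Lemma split_smooth g s : uniq s -> size s = (2 * g).+1%N -> smooth_weq g (curve s).
Proof.
move=> us ss; set f := \prod_(e <- s) ('X - e%:P).
have sf : size f = (2 * g).+2%N by rewrite size_prod_XsubC ss.
split=> [x y []|u v []]; rewrite /on_curve /weq_infty /= ?rev_poly0 deriv0 !horner0.
  rewrite mul0r !addr0 => yf /double_eq0 y0 /esym/eqP.
  by apply/negP/split_simple_root => //; rewrite rootE -yf y0 expr0n.
rewrite mul0r !addr0 => vf /double_eq0 v0 /esym du.
move: vf; rewrite v0 expr0n /= => /esym Ru.
(* At [u = 0] the derivative of the reversed polynomial is the leading coefficient of [f], whose
   degree is one less than [2g + 2]. *)
have [u0|un0] := eqVneq u 0.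
  move/eqP: du; rewrite u0 horner_coef0 coef_deriv coef_poly /= subn1 /=.
  have -> : f`_(2 * g).+1%N = lead_coef f by rewrite lead_coefE sf.
  by rewrite (monicP (monic_prod_XsubC _ _ _)) oner_eq0.
(* Away from 0, a multiple root of the reversed polynomial is the inverse of a multiple root of
   [f]. *)
have sf' : (size f <= (2 * g).+3)%N by rewrite sf.
move/eqP: Ru; rewrite horner_rev_poly // mulf_eq0 expf_eq0 (negPf un0) andbF /= => /eqP fu.
have := horner_deriv_rev_poly sf' un0; rewrite du mulr0 fu mul0rn sub0r => /esym/eqP.
rewrite mulf_eq0 expf_eq0 (negPf un0) andbF oppr_eq0 mulf_eq0 invr_eq0 (negPf un0) /=.
by apply/negP/split_simple_root => //; apply/eqP.
Qed.

End Smoothness.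

(** * The family of curves *)

Section BranchPoints.
Variables (g : nat).

(** These are the [2g + 1] finite branch points; the degree being odd, infinity is the last one.
    Exponent 0 contributes 1 and -1. *)
Definition branch_points (k : nzRingType) (t : k) : seq k :=
  0 :: [seq t ^+ i | i <- iota 0 g] ++ [seq - t ^+ i | i <- iota 0 g].

Definition branch_curve (k : nzRingType) (t : k) : weq k :=
  Weq 0 (\prod_(e <- branch_points t) ('X - e%:P)).

Lemma size_branch_points (k : nzRingType) (t : k) :
  size (branch_points t) = (2 * g).+1%N.
Proof. by rewrite /= size_cat !size_map size_iota addnn mul2n. Qed.

Lemma map_branch_points (k E : nzRingType) (phi : {rmorphism k -> E}) t :
  map phi (branch_points t) = branch_points (phi t).
Proof.
rewrite /= rmorph0 map_cat -!map_comp; congr (_ :: _ ++ _).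
  by apply: eq_map => i /=; rewrite rmorphXn.
by apply: eq_map => i /=; rewrite rmorphN rmorphXn.
Qed.

Lemma map_branch_curve (k E : nzRingType) (phi : {rmorphism k -> E}) t :
  map_weq phi (branch_curve t) = branch_curve (phi t).
Proof.
rewrite /map_weq /branch_curve /= rmorph0; congr Weq.
rewrite -map_branch_points big_map.
transitivity (\prod_(e <- branch_points t) map_poly phi ('X - e%:P)).
  by elim/big_rec2: _ => [|e p q _ <-]; rewrite ?rmorph1 // rmorphM.
by apply: eq_bigr => e _; rewrite rmorphB /= map_polyX map_polyC.
Qed.

(** The squares [t^(2i)] are nonzero and distinct, and [t^i] differs from [-t^i] because 2 is
    nonzero. *)
Lemma uniq_branch_points (k : fieldType) (t : k) : 2%:R != 0 :> k -> t != 0 ->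
    (forall i, (0 < i < g)%N -> t ^+ (2 * i) != 1) ->
  uniq (branch_points t).
Proof.
move=> two0 t0 t1.
have tX i j : (i < j < g)%N -> (t ^+ i) ^+ 2 != (t ^+ j) ^+ 2.
  case/andP=> ij jg; apply/eqP => tij.
  have ji : (0 < j - i < g)%N by lia.
  case/eqP: (t1 _ ji); rewrite -!exprM in tij; apply/(mulfI (expf_neq0 (i * 2) t0)).
  by rewrite mulr1 -exprD tij; congr (_ ^+ _); lia.
have tX2 i j : (i < g)%N -> (j < g)%N -> (t ^+ i) ^+ 2 = (t ^+ j) ^+ 2 -> i = j.
  move=> ig jg /eqP; case: (ltngtP i j) => // ij.
    by rewrite (negPf (tX i j _)) // ij.
  by rewrite eq_sym (negPf (tX j i _)) // ij.
rewrite /= mem_cat negb_or cat_uniq -andbA; apply/and5P; split.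
- by apply/mapP => -[i _ /esym/eqP]; rewrite expf_eq0 (negPf t0) andbF.
- by apply/mapP => -[i _ /esym/eqP]; rewrite oppr_eq0 expf_eq0 (negPf t0) andbF.
- rewrite map_inj_in_uniq ?iota_uniq // => i j; rewrite !mem_iota /= !add0n => ig jg tij.
  by apply: tX2; rewrite ?tij.
- apply/hasPn => _ /mapP[i + ->]; rewrite mem_iota add0n => /= ig.
  apply/mapP => -[j]; rewrite mem_iota add0n /= => jg tij.
  have ij : i = j by apply: tX2; rewrite // -tij sqrrN.
  move/eqP: tij; rewrite ij eq_sym -addr_eq0 -mulr2n -mulr_natl mulf_eq0 (negPf two0).
  by rewrite expf_eq0 (negPf t0) andbF.
- rewrite map_inj_in_uniq ?iota_uniq // => i j; rewrite !mem_iota /= !add0n => ig jg tij.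
  by apply: tX2; rewrite // -sqrrN tij sqrrN.
Qed.

End BranchPoints.

(** * Finiteness of the branch curves isomorphic to a given one *)

Section Finiteness.
Variables (g : nat) (k : closedFieldType).
Hypotheses (g_ge2 : (2 <= g)%N) (two_neq0 : 2%:R != 0 :> k).

(* A Moebius transformation is determined by its values at 0, 1 and -1. *)
Lemma moebius_eq (a b c d a' b' c' d' t t' : k) :
    let agree e e' := (a + b * e) * (c' + d' * e') = (a' + b' * e') * (c + d * e) in
    a * d - b * c != 0 -> a' * d' - b' * c' != 0 ->
    agree 0 0 -> agree 1 1 -> agree (-1) (-1) -> agree t t' ->
  t = t'.
Proof.
move=> agree det det' h0 h1 h2 ht; rewrite /agree in h0 h1 h2 ht.
(* The two sides of [agree e e] differ by a polynomial of degree at most 2 in [e] vanishing at 0, 1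
   and -1; [e0], [e1] and [e2] say that its coefficients vanish. *)
have e0 : a * c' = a' * c by move: h0; rewrite !mulr0 !addr0.
have e2 : b * d' = b' * d.
  apply: (mulfI two_neq0).
  have -> : 2%:R * (b * d') = (a + b * 1) * (c' + d' * 1) + (a + b * -1) * (c' + d' * -1)
     - 2%:R * (a * c') by ring.
  by rewrite h1 h2 e0; ring.
have e1 : a * d' + b * c' = a' * d + b' * c.
  apply: (mulfI two_neq0).
  have -> : 2%:R * (a * d' + b * c') = (a + b * 1) * (c' + d' * 1) - (a + b * -1) * (c' + d' * -1)
     by ring.
  by rewrite h1 h2; ring.
have h' : (a + b * t') * (c' + d' * t') = (a' + b' * t') * (c + d * t').
  transitivity (a * c' + (a * d' + b * c') * t' + b * d' * t' ^+ 2); first by ring.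
  by rewrite e0 e1 e2; ring.
have det_eq u u' : (a * d - b * c) * (t' - t) =
  (a + b * t) * (c + d * t') - (a + b * t') * (c + d * t) + 0 * u * u' by ring.
(* The first determinant times [t' - t] is killed by the denominator and by the numerator of the
   second map at [t']; by [det'] these are not both zero. *)
have eq_c : (c' + d' * t') * ((a * d - b * c) * (t' - t)) = 0.
  transitivity ((a + b * t) * (c' + d' * t') * (c + d * t')
    - (a + b * t') * (c' + d' * t') * (c + d * t)); first by ring.
  by rewrite ht h'; ring.
have eq_a : (a' + b' * t') * ((a * d - b * c) * (t' - t)) = 0.
  transitivity ((a + b * t) * ((a' + b' * t') * (c + d * t'))
    - (a + b * t') * ((a' + b' * t') * (c + d * t))); first by ring.
  by rewrite -ht -h'; ring.
apply/esym/eqP; rewrite -subr_eq0 -(mulrI_eq0 _ (mulfI det)); apply/eqP.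
set z := (_ * _) in eq_c eq_a *; apply: contrapT => /eqP zn0.
move/eqP: eq_c; rewrite mulf_eq0 (negPf zn0) orbF => /eqP c0.
move/eqP: eq_a; rewrite mulf_eq0 (negPf zn0) orbF => /eqP a0.
have c'E : c' = - (d' * t') by apply/eqP; rewrite -addr_eq0 c0.
have a'E : a' = - (b' * t') by apply/eqP; rewrite -addr_eq0 a0.
by case/eqP: det'; rewrite a'E c'E; ring.
Qed.

(** [option k] is the projective line, [None] being infinity. *)
Definition moebius (M : k * k * k * k) (e : k) : option k :=
  let: (a, b, c, d) := M in
  if c + d * e == 0 then None else Some ((a + b * e) / (c + d * e)).

Definition moebius_det (M : k * k * k * k) : k :=
  let: (a, b, c, d) := M in a * d - b * c.

Lemma moebius_inj (M M' : k * k * k * k) t t' :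
    moebius_det M != 0 -> moebius_det M' != 0 ->
    (forall e, e \in [:: 0; 1; -1] -> moebius M e = moebius M' e) ->
    moebius M t = moebius M' t' -> t = t'.
Proof.
move: M M' => [[[a b] c] d] [[[a' b'] c'] d'] /= det det' eqM eqt.
have agree e e' :
    (if c + d * e == 0 then None else Some ((a + b * e) / (c + d * e))) =
      (if c' + d' * e' == 0 then None else Some ((a' + b' * e') / (c' + d' * e'))) ->
    (a + b * e) * (c' + d' * e') = (a' + b' * e') * (c + d * e).
  have [->|c0] := eqVneq (c + d * e) 0; have [->|c'0] := eqVneq (c' + d' * e') 0 => //.
    by rewrite !mulr0.
  by case=> /eqP; rewrite eqr_div // => /eqP.
apply: moebius_eq det det' (agree _ _ (eqM 0 _)) (agree _ _ (eqM 1 _))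
  (agree _ _ (eqM (-1) _)) (agree _ _ eqt); by rewrite !inE eqxx ?orbT.
Qed.

Lemma mem_branch_points (t : k) :
  {subset [:: 0; 1; -1; t] <= branch_points g t}.
Proof.
have i0 : 0%N \in iota 0 g by rewrite mem_iota; lia.
have i1 : 1%N \in iota 0 g by rewrite mem_iota; lia.
move=> e; rewrite !inE mem_cat => /or4P[] /eqP ->; rewrite ?eqxx //; apply/orP; right; apply/orP.
- by left; apply/mapP; exists 0%N.
- by right; apply/mapP; exists 0%N.
- by left; apply/mapP; exists 1%N.
Qed.

Lemma isomorphic_moebius (t t0 : k) :
    uniq (branch_points g t) -> uniq (branch_points g t0) ->
    isomorphic (branch_curve g t) (branch_curve g t0) ->
  exists2 M, moebius_det M != 0 & forall e, e \in branch_points g t ->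
    moebius M e \in None :: map Some (branch_points g t0).
Proof.
move=> ut ut0 [E [i [x1 [y1 [x2 [y2 [xy1 xy2]]]]]]].
have s5 (u : k) : (5 <= size (branch_points g u))%N by rewrite size_branch_points; lia.
have s_odd : odd (size (branch_points g t0)) by rewrite size_branch_points /= mul2n odd_double.
have [a [b [c [d [det ptsP]]]]] :=
  generic_branch_points two_neq0 ut (s5 _) ut0 (s5 _) s_odd xy1 xy2.
exists (a, b, c, d) => // e es; rewrite /moebius.
have [//|cd0] := eqVneq (c + d * e) 0.
case: (ptsP e es) => [/eqP|[e' e's ->]]; first by rewrite (negPf cd0).
by rewrite mulfK // in_cons; apply/orP; right; apply: map_f.
Qed.

Local Open Scope classical_set_scope.

(** The images of 0, 1, -1 and [t] under a Moebius map preserving branch points lie in a finite set,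
    and they determine [t] by [moebius_inj]. *)
Lemma finite_isomorphic_branch_curves (t0 : k) : uniq (branch_points g t0) ->
  finite_set [set t | uniq (branch_points g t) /\
                      isomorphic (branch_curve g t) (branch_curve g t0)].
Proof.
move=> ut0; set A := [set t | _].
pose S := None :: map Some (branch_points g t0).
have /choice[M MP] t : exists M, A t -> moebius_det M != 0 /\
    forall e, e \in branch_points g t -> moebius M e \in S.
  have [[ut iso_t]|nAt] := pselect (A t); last by exists (0, 0, 0, 0).
  by have [M det MP] := isomorphic_moebius ut ut0 iso_t; exists M.
(* The value [None] off [A] keeps the preimage of [B] inside [A], and [v] is injective on that
   preimage. *)
pose v t := if `[< A t >] then
  Some (moebius (M t) 0, moebius (M t) 1, moebius (M t) (-1), moebius (M t) t) else None.
pose B := [set Some u | u in [set` S] `*` [set` S] `*` [set` S] `*` [set` S]].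
have vA t : (v @^-1` B) t -> A t.
  by rewrite /= /v; case: asboolP => // _ [].
apply: (sub_finite_set (B := v @^-1` B)) => [t At|].
  rewrite /= /v; case: asboolP => // _.
  have [_ tS] := MP t At.
  have mS e : e \in [:: 0; 1; -1; t] -> moebius (M t) e \in S by move/mem_branch_points/tS.
  eexists; last by [].
  by split; [split; [split|]|] => /=; apply: mS; rewrite !inE eqxx ?orbT.
apply: finite_preimage => [t t' /set_mem/vA At /set_mem/vA At'|].
  rewrite /v; case: asboolP => // _; case: asboolP => // _ [e0 e1 e2 e3].
  have [det _] := MP t At; have [det' _] := MP t' At'.
  by apply: moebius_inj det det' _ e3 => e; rewrite !inE => /or3P[] /eqP ->.
by apply/finite_image/finite_setX; [apply: finite_setX; [apply: finite_setX|]|]; apply: finite_seq.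
Qed.

End Finiteness.

(** * Reduction of the branch curves *)

Section ResidueMorphism.
Variables (K : fieldExtType rat) (p : set K) (E : fieldType) (phi : K -> E).
Hypotheses (p_prime : is_prime p) (phi_res : residue_morphism p phi).
Local Notation OK := (integers_pred K).

Lemma integers_local x : x \in OK -> local_ring p x.
Proof.
move=> Ox; exists x, 1; split; rewrite ?divr1 //; try exact/integersP.
- exact/integersP/rpred1.
- exact: prime1.
Qed.

Lemma residue1 : phi 1 = 1. Proof. by case: phi_res. Qed.

Lemma residueD x y : x \in OK -> y \in OK -> phi (x + y) = phi x + phi y.
Proof. by case: phi_res => _ phiD _ _ Ox Oy; apply: phiD; apply: integers_local. Qed.

Lemma residueM x y : x \in OK -> y \in OK -> phi (x * y) = phi x * phi y.
Proof. by case: phi_res => _ _ phiM _ Ox Oy; apply: phiM; apply: integers_local. Qed.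

Lemma residue0 : phi 0 = 0.
Proof. by case: phi_res => _ _ _; apply; apply: prime0. Qed.

Lemma residueN x : x \in OK -> phi (- x) = - phi x.
Proof.
move=> Ox; apply/eqP; rewrite -addr_eq0 -residueD ?rpredN //.
by rewrite addNr residue0.
Qed.

Lemma residueX x n : x \in OK -> phi (x ^+ n) = phi x ^+ n.
Proof.
move=> Ox; elim: n => [|n IHn]; first exact: residue1.
by rewrite !exprS residueM ?rpredX // IHn.
Qed.

Lemma residue_sum n (F : 'I_n -> K) : (forall i, F i \in OK) ->
  phi (\sum_i F i) = \sum_i phi (F i).
Proof.
elim: n F => [|n IHn] F OF; first by rewrite !big_ord0 residue0.
rewrite !big_ord_recr /= -(IHn (fun i => F (widen_ord _ i))) // residueD //.
exact: rpred_sum.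
Qed.

(** The inverse of [x] is in the local ring, so the image of [x] is invertible. *)
Lemma residue_neq0 x : x \in OK -> ~ p x -> phi x != 0.
Proof.
move=> Ox npx; have x0 : x != 0 by apply/eqP => x0; apply: npx; rewrite x0; apply: prime0.
have : phi (x * x^-1) = phi x * phi x^-1.
  case: phi_res => _ _ phiM _; apply: phiM; first exact: integers_local.
  exists 1, x; split; rewrite ?div1r //; try exact/integersP.
  exact/integersP/rpred1.
rewrite divff // residue1; apply: contra_eqN => /eqP ->.
by rewrite mul0r oner_eq0.
Qed.

(** The coefficients are integral because [phi] is additive and multiplicative on the local ring
    only. *)
Lemma residue_poly_mul (a b : {poly K}) : a \is a polyOver OK -> b \is a polyOver OK ->
  map_poly phi (a * b) = map_poly phi a * map_poly phi b.
Proof.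
move=> /polyOverP Oa /polyOverP Ob; apply/polyP => i.
rewrite coef_map_id0 ?residue0 // !coefM residue_sum => [|j]; last by rewrite rpredM.
by apply: eq_bigr => j _; rewrite residueM // !coef_map_id0 ?residue0.
Qed.

Lemma residue_prodXsubC (s : seq K) : {subset s <= OK} ->
  map_poly phi (\prod_(e <- s) ('X - e%:P)) = \prod_(e <- map phi s) ('X - e%:P).
Proof.
rewrite big_map; elim: s => [|e s IHs] Os.
  rewrite !big_nil -[1]/(1%:P) -[RHS]/(1%:P); apply/polyP => i.
  by rewrite coef_map_id0 ?residue0 // !coefC; case: eqP; rewrite ?residue1 ?residue0.
have Oe : e \in OK by apply: Os; rewrite mem_head.
have {}Os : {subset s <= OK} by move=> u us; apply: Os; rewrite inE us orbT.
rewrite !big_cons residue_poly_mul; last 2 first.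
- by rewrite rpredB ?polyOverX ?polyOverC.
- by rewrite big_seq rpred_prod // => u /Os Ou; rewrite rpredB ?polyOverX ?polyOverC.
rewrite IHs //; congr (_ * _); apply/polyP => i.
rewrite coef_map_id0 ?residue0 // !coefB !coefX !coefC.
case: i => [|[|i]]; rewrite /= ?subr0 ?sub0r ?residueN ?residue0 //.
by rewrite residue1.
Qed.

Lemma residue_branch_curve g t : t \in OK ->
  map_weq phi (branch_curve g t) = branch_curve g (phi t).
Proof.
move=> Ot; rewrite /map_weq /branch_curve /=; congr Weq.
  by apply/polyP => i; rewrite coef_map_id0 ?residue0 // !coef0 residue0.
rewrite residue_prodXsubC => [|e]; last first.
  rewrite /branch_points inE mem_cat => /predU1P[->|]; first exact: rpred0.
  by case/orP=> /mapP[i _ ->]; rewrite ?rpredN rpredX.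
congr (\prod_(e <- _) _); rewrite /= residue0 map_cat -!map_comp.
congr (_ :: _ ++ _); apply: eq_map => i /=; first by rewrite residueX.
by rewrite residueN ?rpredX // residueX.
Qed.

End ResidueMorphism.

(** * Good reduction and rationality of the Weierstrass points *)

Section BranchCurve.
Variables (g : nat) (K : fieldExtType rat) (t : K).
Hypothesis t_integer : t \in integers_pred K.

Lemma weq_degree_branch_curve (k : fieldType) (u : k) :
  weq_degree g (branch_curve g u).
Proof. by split; rewrite ?size_poly0 // size_prod_XsubC size_branch_points. Qed.

Lemma number_field_natr_neq0 n : (0 < n)%N -> n%:R != 0 :> K.
Proof. by move=> n0; rewrite -(rmorph_nat (in_alg K)) fmorph_eq0 pnatr_eq0 -lt0n. Qed.

Hypothesis uniq_t : uniq (branch_points g t).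

(** The curve is its own model, over [K] itself: the conditions keep the branch points distinct
    modulo [p], in residue characteristic other than 2. *)
Lemma good_reduction_branch_curve (p : set K) : is_prime p ->
    ~ p 2%:R -> ~ p t -> (forall i, (0 < i < g)%N -> ~ p (t ^+ (2 * i) - 1)) ->
  potentially_good_reduction g p (branch_curve g t).
Proof.
move=> p_prime np2 npt npt1.
have idE (x : K) : (id_ahom K : K -> K) x = x by exact: id_lfunE.
exists K, (id_ahom K), p.
have -> : map_weq (id_ahom K) (branch_curve g t) = branch_curve g t.
  by rewrite map_branch_curve; congr branch_curve; apply: idE.
split=> //; first by rewrite /preimage; apply/seteqP; split=> x /=; rewrite idE.
exists (branch_curve g t); split.
- exact: weq_degree_branch_curve.
- move=> i; split; apply: integers_local => //; first by rewrite coef0 rpred0.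
  move: i; apply/polyOverP; rewrite -[weq_f _]/(\prod_(e <- branch_points g t) ('X - e%:P)).
  rewrite big_seq rpred_prod // => e.
  rewrite /branch_points inE mem_cat => es; rewrite rpredB ?polyOverX ?polyOverC //.
  by case/predU1P: es => [->|/orP[] /mapP[i _ ->]]; rewrite ?rpred0 ?rpredN ?rpredX.
- by apply: isomorphic_refl.
move=> E phi phi_res; rewrite (residue_branch_curve p_prime phi_res) //.
have two : 2%:R != 0 :> E.
  have <- : phi 2%:R = 2%:R.
    rewrite -[2%:R]/(1 + 1) (residueD p_prime phi_res) ?rpred1 //.
    by rewrite (residue1 phi_res).
  by apply: (residue_neq0 p_prime phi_res); rewrite ?rpred_nat.
apply: split_smooth => //; last exact: size_branch_points.
apply: uniq_branch_points => // [|i ig].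
  exact: (residue_neq0 p_prime phi_res).
rewrite -(residueX p_prime phi_res) // -subr_eq0 -[1](residue1 phi_res).
rewrite -(residueN p_prime phi_res) ?rpred1 // -(residueD p_prime phi_res) ?rpredX ?rpredN ?rpred1 //.
by apply: (residue_neq0 p_prime phi_res); [rewrite rpredB ?rpredX ?rpred1|exact: npt1].
Qed.

Variables (Kbar : closedFieldType) (iota : {rmorphism K -> Kbar}).

Lemma closure_two_neq0 : 2%:R != 0 :> Kbar.
Proof. by rewrite -(rmorph_nat iota) fmorph_eq0 number_field_natr_neq0. Qed.

Lemma uniq_iota_branch_points : uniq (branch_points g (iota t)).
Proof. by rewrite -map_branch_points map_inj_uniq //; apply: fmorph_inj. Qed.

Lemma hyperelliptic_branch_curve : hyperelliptic_curve g iota (branch_curve g t).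
Proof.
split; first exact: weq_degree_branch_curve.
rewrite map_branch_curve; apply: split_smooth.
- exact: closure_two_neq0.
- exact: uniq_iota_branch_points.
- exact: size_branch_points.
Qed.

Lemma rational_branch_curve : rational_weierstrass_points g iota (branch_curve g t).
Proof.
move=> x y; rewrite map_branch_curve.
have rootE e : (\prod_(e <- branch_points g (iota t)) ('X - e%:P)).[e] = 0 -> range iota e.
  move/eqP; rewrite -rootE root_prod_XsubC -map_branch_points => /mapP[u _ ->].
  by exists u.
have range0 : range iota 0 by exists 0; rewrite ?rmorph0.
case=> -[]; rewrite /on_curve /weq_infty /= ?rev_poly0 horner0 mul0r !addr0 => xy.
  move/(double_eq0 closure_two_neq0) => y0; rewrite y0; split=> //.
  by apply: rootE; rewrite -xy y0 expr0n.
move/(double_eq0 closure_two_neq0) => y0; rewrite y0; split=> //.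
(* In the chart at infinity, a nonzero root is the inverse of a finite branch point. *)
have [->//|x0] := eqVneq x 0.
move/esym/eqP: xy; rewrite y0 expr0n horner_rev_poly //; last first.
  by rewrite size_prod_XsubC size_branch_points.
rewrite mulf_eq0 expf_eq0 (negPf x0) andbF /= => /eqP/rootE[u _ ux].
by exists u^-1; rewrite // fmorphV ux invrK.
Qed.

End BranchCurve.

(** * Factors of the cyclotomic polynomials over a number field *)

Lemma root_dvdp_trans (F : fieldType) (p q : {poly F}) x : p %| q -> root p x -> root q x.
Proof. by rewrite !root_factor_theorem => pq /dvdp_trans; apply. Qed.

(** Since [z^n = 1], [z] is a root of [Phi_d] for some [d] dividing [n]; then [z^d = 1], so [n]
    divides [d]. *)
Lemma Cyclotomic_root (F : fieldType) (z : F) n : n.-primitive_root z ->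
  root (map_poly intr 'Phi_n) z.
Proof.
move=> z_prim; have n0 := prim_order_gt0 z_prim.
have := congr1 (fun p => (map_poly intr p : {poly F}).[z]) (prod_Cyclotomic n0).
rewrite rmorph_prod rmorphB /= map_polyXn rmorph1 horner_prod !hornerE.
rewrite prim_expr_order // subrr => /eqP; rewrite prodf_seq_eq0 => /hasP[d + /=].
rewrite -dvdn_divisors // => dn dz; suff <- : d = n by [].
have d0 : (0 < d)%N by apply: dvdn_gt0 dn.
apply/eqP; rewrite eqn_dvd dn (prim_order_dvd z_prim) /=.
have := congr1 (fun p => (map_poly intr p : {poly F}).[z]) (prod_Cyclotomic d0).
rewrite (bigD1_seq d) ?divisors_uniq -?dvdn_divisors //= rmorphM rmorphB /= map_polyXn rmorph1.
by rewrite hornerM (eqP dz) mul0r !hornerE => /esym/eqP; rewrite subr_eq0.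
Qed.

(** Irreducibility of [Phi_n] is carried over from [algC]: the minimal polynomial [m] of [z] divides
    [Phi_n], so its root [w] in [algC] is a primitive [n]-th root of unity, whose minimal polynomial
    has degree [totient n] and divides [m]. *)
Lemma totient_dim_le (L : fieldExtType rat) (z : L) n : n.-primitive_root z ->
  (totient n <= \dim <<1; z>>)%N.
Proof.
move=> z_prim; have n0 := prim_order_gt0 z_prim.
have /polyOver1P[m mE] := minPolyOver 1%AS z.
have size_m : size m = (\dim <<1; z>>%VS).+1.
  by rewrite dim_Fadjoin dimv1 muln1 -size_minPoly mE size_map_poly.
have m_Phi : m %| map_poly intr 'Phi_n.
  rewrite -(dvdp_map (in_alg L)) -mE minPoly_dvdp //.
    by apply/polyOver1P; exists (map_poly intr 'Phi_n).
  rewrite -map_poly_comp (eq_map_poly (g := intr)) ?Cyclotomic_root // => c /=.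
  by rewrite scaler_int.
have [w mw] : exists w : algC, root (map_poly ratr m) w.
  apply/closed_rootP; rewrite size_map_poly size_m eqSS -lt0n.
  by rewrite adim_gt0.
have [z0 z0_prim] := C_prim_root_exists n0.
have w_prim : n.-primitive_root w.
  rewrite -(root_cyclotomic z0_prim) -(Cintr_Cyclotomic z0_prim).
  have <- : map_poly ratr (map_poly intr 'Phi_n) = map_poly intr 'Phi_n :> {poly algC}.
    rewrite -map_poly_comp; apply: eq_map_poly => c /=.
    by rewrite ratr_int.
  by apply: root_dvdp_trans mw; rewrite dvdp_map.
have [p [pE p_monic] pP] := minCpolyP w.
have : p %| m by rewrite -pP.
move/dvdp_leq; rewrite -size_poly_eq0 size_m => /(_ isT).
rewrite -(size_map_poly (ratr : {rmorphism rat -> algC})) -pE.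
by rewrite (minCpoly_cyclotomic w_prim) size_cyclotomic ltnS.
Qed.

Section MinPoly.
Variables (K L : fieldExtType rat) (j : 'AHom(K, L)).

(** The coefficients of the minimal polynomial are in [limg j], where [j] can be inverted. *)
Definition min_poly_over (w : L) : {poly K} := map_poly (j^-1)%VF (minPoly (limg j) w).

Lemma map_min_poly_over w : map_poly j (min_poly_over w) = minPoly (limg j) w.
Proof.
apply/polyP => i; rewrite coef_map coef_map_id0 ?linear0 //.
by apply: limg_lfunVK; move: i; apply/polyOverP/minPolyOver.
Qed.

Lemma limg_polyOver (p : {poly K}) : map_poly j p \is a polyOver (limg j).
Proof. by apply/polyOverP => i; rewrite coef_map memv_img // memvf. Qed.

Lemma min_poly_over_monic w : min_poly_over w \is monic.
Proof. by rewrite -(map_monic j) map_min_poly_over monic_minPoly. Qed.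

Lemma size_min_poly_over w : size (min_poly_over w) = (adjoin_degree (limg j) w).+1.
Proof. by rewrite -(size_map_poly j) map_min_poly_over size_minPoly. Qed.

Lemma min_poly_over_root w : root (map_poly j (min_poly_over w)) w.
Proof. by rewrite map_min_poly_over root_minPoly. Qed.

Lemma min_poly_over_dvdp w p : (min_poly_over w %| p) = root (map_poly j p) w.
Proof.
rewrite -(dvdp_map j) map_min_poly_over; apply/idP/idP => [/root_dvdp_trans|wp].
  by apply; apply: root_minPoly.
by rewrite minPoly_dvdp // limg_polyOver.
Qed.

Lemma min_poly_over_irreducible w : irreducible_poly (min_poly_over w).
Proof.
split=> [|q q1 qw]; first by rewrite size_min_poly_over.
rewrite -(dvdp_map j) map_min_poly_over in qw.
have := minPoly_irr (limg_polyOver q) qw.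
by rewrite -map_min_poly_over !eqp_map -size_poly_eq1 size_map_poly (negPf q1) orbF.
Qed.

Lemma min_poly_over_unity w d : w ^+ d = 1 -> min_poly_over w %| 'X^d - 1.
Proof.
move=> wd; rewrite min_poly_over_dvdp rmorphB /= map_polyXn rmorph1.
by rewrite rootE !hornerE wd subrr.
Qed.

(** For [z] of order [d], these are the distinct irreducible factors of [Phi_d] over [K]; roots
    conjugate over [K] share one, whence [undup]. *)
Definition cyclotomic_factors (z : L) (d : nat) : seq {poly K} :=
  undup [seq min_poly_over (z ^+ i) | i <- iota 0 d & coprime i d].

Lemma prod_irreducible_dvdp (s : seq {poly K}) (p : {poly K}) : uniq s ->
    (forall f, f \in s -> [/\ f \is monic, irreducible_poly f & f %| p]) ->
  \prod_(f <- s) f %| p.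
Proof.
elim: s => [|f s IHs] /=; first by rewrite big_nil dvd1p.
case/andP=> fs us sP; rewrite big_cons.
have [f_monic f_irr fp] := sP f (mem_head _ _).
have {}sP h : h \in s -> [/\ h \is monic, irreducible_poly h & h %| p].
  by move=> hs; apply: sP; rewrite inE hs orbT.
have {}IHs := IHs us sP.
rewrite Gauss_dvdp ?fp ?IHs // irreducible_poly_coprime //.
apply/negP; rewrite big_seq => f_prod.
suff [h hs fh] : exists2 h, h \in s & f %| h.
  have [h_monic [_ h_irr] _] := sP h hs.
  case: f_irr => f_gt1 _; have := h_irr f; rewrite fh (gtn_eqF f_gt1) => /(_ isT isT).
  by rewrite eqp_monic // => /eqP fhE; move: fs; rewrite fhE hs.
move: f_prod; rewrite -big_seq; elim: (s) => [|h r IHr].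
  rewrite big_nil dvdp1 => /eqP f1.
  by case: f_irr; rewrite f1.
rewrite big_cons; have [fh _|nfh] := boolP (f %| h); first by exists h; rewrite ?mem_head.
rewrite Gauss_dvdpr ?irreducible_poly_coprime // => /IHr[h' h'r fh'].
by exists h' => //; rewrite inE h'r orbT.
Qed.

Lemma adjoin_degree_prim z d i : d.-primitive_root z -> coprime i d ->
  adjoin_degree (limg j) (z ^+ i) = adjoin_degree (limg j) z.
Proof.
move=> z_prim id; rewrite !adjoin_degreeE; congr (\dim _ %/ _)%N.
have zi_prim : d.-primitive_root (z ^+ i) by rewrite prim_root_exp_coprime.
have [h zE] := prim_rootP zi_prim (prim_expr_order z_prim).
apply/eqP; rewrite eqEsubv; apply/andP; split.
  by apply/FadjoinP; rewrite subv_adjoin rpredX // memv_adjoin.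
by apply/FadjoinP; rewrite subv_adjoin {1}zE rpredX // memv_adjoin.
Qed.

(** All the factors have the degree of [K(z)] over [K], and their product divides [Phi_d]. *)
Lemma size_cyclotomic_factors z d : d.-primitive_root z ->
  (size (cyclotomic_factors z d) * adjoin_degree (limg j) z <= totient d)%N.
Proof.
move=> z_prim; set s := cyclotomic_factors z d.
have sP f : f \in s ->
    [/\ f \is monic, irreducible_poly f & size f = (adjoin_degree (limg j) z).+1].
  rewrite mem_undup => /mapP[i]; rewrite mem_filter => /andP[id _] ->.
  rewrite min_poly_over_monic size_min_poly_over (adjoin_degree_prim z_prim) //.
  by split=> //; apply: min_poly_over_irreducible.
have sPhi : \prod_(f <- s) f %| map_poly intr 'Phi_d.
  apply: prod_irreducible_dvdp => [|f fs]; first exact: undup_uniq.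
  have [f_monic f_irr _] := sP f fs; split=> //.
  move: fs; rewrite mem_undup => /mapP[i]; rewrite mem_filter => /andP[id _] ->.
  rewrite min_poly_over_dvdp -map_poly_comp (eq_map_poly (g := intr)).
    by rewrite Cyclotomic_root // prim_root_exp_coprime.
  by move=> c /=; rewrite rmorph_int.
have Phi_monic : map_poly intr 'Phi_d \is @monic K.
  by rewrite monic_map ?Cyclotomic_monic.
have /(dvdp_leq (monic_neq0 Phi_monic)) := sPhi.
have -> : size (map_poly intr 'Phi_d : {poly K}) = (totient d).+1.
  rewrite -(size_Cyclotomic d) size_map_poly_id0 // (monicP (Cyclotomic_monic d)).
  by rewrite rmorph1 oner_neq0.
suff -> : size (\prod_(f <- s) f) = (size s * adjoin_degree (limg j) z).+1%N by rewrite ltnS.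
elim: (s) sP => [|f r IHr] rP; first by rewrite big_nil size_poly1.
have [f_monic _ sf] := rP f (mem_head _ _).
have {}rP h : h \in r ->
    [/\ h \is monic, irreducible_poly h & size h = (adjoin_degree (limg j) z).+1].
  by move=> hr; apply: rP; rewrite inE hr orbT.
have prod_monic : \prod_(h <- r) h \is monic.
  by rewrite big_seq monic_prod // => h /rP[].
have fn0 := monic_neq0 f_monic.
by rewrite big_cons (size_Mmonic fn0 prod_monic) sf (IHr rP) /= addnS mulSn.
Qed.

Lemma card_cyclotomic_factors z d n : \dim {:K} = n -> d.-primitive_root z ->
  (size (cyclotomic_factors z d))%:R <=
    n%:R / (\dim_(<<1; z>>%VS) <<limg j; z>>%VS)%:R :> rat.
Proof.
move=> dimK z_prim; set D := adjoin_degree (limg j) z; set E := \dim_ _ _.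
have dim_limg : \dim (limg j) = n.
  rewrite limg_dim_eq ?dimK //; apply/eqP; rewrite -subv0.
  apply/subvP => x /memv_capP[_]; rewrite memv_ker memv0.
  by rewrite fmorph_eq0.
have e0 : (0 < \dim <<1; z>>)%N by rewrite adim_gt0.
(* The degree of [K(z)] over Q, through [Q(z)] and through [K]; the quotient [E] of natural numbers
   is exact because [Q(z)] is inside [K(z)]. *)
have dimE : (E * \dim <<1; z>> = D * n)%N.
  rewrite /E divnK; first by rewrite dim_Fadjoin dim_limg.
  rewrite field_dimS //; apply/FadjoinP; rewrite memv_adjoin sub1v.
  by split.
have D0 : (0 < D)%N.
  by rewrite -(ltn_pmul2r (adim_gt0 (limg j))) mul0n -dim_Fadjoin adim_gt0.
have n0 : (0 < n)%N by rewrite -dim_limg adim_gt0.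
have E0 : (0 < E)%N.
  have : (0 < E * \dim <<1; z>>)%N by rewrite dimE muln_gt0 D0.
  by rewrite muln_gt0 => /andP[].
rewrite ler_pdivlMr ?ltr0n // -natrM ler_nat.
rewrite -(leq_pmul2r D0) [(n * D)%N]mulnC -dimE mulnAC [(E * _)%N]mulnC leq_mul2r.
apply/orP; right; apply: leq_trans (size_cyclotomic_factors z_prim) _.
exact: totient_dim_le.
Qed.

End MinPoly.

(** * Prime values of the cyclotomic factors *)

Lemma integers_of_closure (K E : fieldType) (iota : {rmorphism K -> E}) x :
  iota x \in integers_pred E -> x \in integers_pred K.
Proof.
case/integral_inP=> P P_monic Px; apply/integral_inP; exists P => //.
rewrite -(fmorph_root iota) -map_poly_comp (eq_map_poly (g := intr)) // => c /=.
by rewrite rmorph_int.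
Qed.

(** The roots of [f] in [E] are roots of [P], hence integral, and the coefficients of [f] are
    polynomials in its roots. *)
Lemma integral_factor (K : fieldType) (E : closedFieldType) (iota : {rmorphism K -> E})
    (f : {poly K}) (P : {poly int}) :
  f \is monic -> P \is monic -> f %| map_poly intr P -> f \is a polyOver (integers_pred K).
Proof.
move=> f_monic P_monic fP; apply/polyOverP => i; apply: (integers_of_closure (iota := iota)).
rewrite -coef_map; move: i; apply/polyOverP.
have [r rE] := closed_field_poly_normal (map_poly iota f).
rewrite rE lead_coef_map (monicP f_monic) rmorph1 scale1r.
rewrite big_seq rpred_prod // => e er; rewrite rpredB ?polyOverX ?polyOverC //.
apply/integral_inP; exists P => //.
have <- : map_poly iota (map_poly intr P) = map_poly intr P.
  by rewrite -map_poly_comp; apply: eq_map_poly => c /=; rewrite rmorph_int.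
apply: (@root_dvdp_trans _ (map_poly iota f)); first by rewrite dvdp_map.
by rewrite rE lead_coef_map (monicP f_monic) rmorph1 scale1r root_prod_XsubC.
Qed.

Lemma irreducible_comp_scale (K : fieldType) (c : K) (p : {poly K}) : c != 0 ->
  irreducible_poly p -> irreducible_poly (p \Po (c *: 'X)).
Proof.
have size_scaleX (a : K) : a != 0 -> size (a *: 'X : {poly K}) = 2%N.
  by move=> a0; rewrite size_scale // size_polyX.
have compK (a b : K) (q : {poly K}) : a * b = 1 -> (q \Po (a *: 'X)) \Po (b *: 'X) = q.
  by move=> ab; rewrite -comp_polyA comp_polyZ comp_polyX scalerA ab scale1r comp_polyXr.
move=> c0 [p1 p_irr]; split=> [|q q1 qp]; first by rewrite size_comp_poly2 ?size_scaleX.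
have c'0 : c^-1 != 0 by rewrite invr_eq0.
have := p_irr (q \Po (c^-1 *: 'X)); rewrite size_comp_poly2 ?size_scaleX // => /(_ q1).
have := dvdp_comp_poly (c^-1 *: 'X) qp; rewrite compK ?divff // => -> /(_ isT).
case/andP=> h1 h2; apply/andP; split=> //.
by have := dvdp_comp_poly (c *: 'X) h2; rewrite compK // mulVf.
Qed.

Lemma exists_primitive_root l : prime l -> exists z : 'F_l, l.-1.-primitive_root z.
Proof.
move=> l_prime; have cardF : #|'F_l| = l := card_Fp l_prime.
pose rs := enum [pred x : 'F_l | x != 0].
have : has l.-1.-primitive_root rs.
  apply: cyclic.has_prim_root; rewrite ?enum_uniq //.
  - by have := prime_gt1 l_prime; case: (l) => // -[].
  - apply/allP => x; rewrite mem_enum inE => x0; rewrite unity_rootE.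
    apply/eqP/(mulfI x0); rewrite mulr1 -exprS prednK ?prime_gt0 //.
    by have := expf_card x; rewrite cardF.
  - have := cardC1 (0 : 'F_l); rewrite cardF -cardE => <-.
    by rewrite (eq_card (B := predC1 0)).
by case/hasP=> z _ z_prim; exists z.
Qed.

Lemma prime_dvdn_fact l n : prime l -> (n < l)%N -> (l %| n`!)%N = false.
Proof.
move=> l_prime; elim: n => [|n IHn] nl.
  by rewrite fact0 dvdn1; apply/eqP => l1; rewrite l1 in l_prime.
by rewrite factS Euclid_dvdM // IHn ?orbF ?(ltnW nl) // gtnNdvd.
Qed.

Lemma monic_Xn_sub_1 (R : nzRingType) n : (0 < n)%N -> ('X^n - 1 : {poly R}) \is monic.
Proof. exact: monicXnsubC. Qed.

(** * The polynomials submitted to hypothesis H *)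

Section CyclotomicValues.
Variables (K : fieldExtType rat) (g : nat).
Hypothesis g_ge2 : (2 <= g)%N.
Variables (Kbar : closedFieldType) (emb : {rmorphism K -> Kbar}).
Variables (L : fieldExtType rat) (j : 'AHom(K, L)) (zeta : nat -> L).
Hypothesis zeta_prim : forall d, d \in D_g g -> d.-primitive_root (zeta d).
Local Notation OK := (integers_pred K).

Definition cyclotomic_list : seq {poly K} :=
  flatten [seq cyclotomic_factors j (zeta d) d | d <- iota 0 (2 * g)%N & d \in D_g g].

Lemma D_g_bounds d : d \in D_g g -> (0 < d < 2 * g)%N.
Proof. by rewrite inE /D_g; lia. Qed.

(** The integral cofactor [c] makes a prime that contains an integral value of [f] contain that of
    ['X^d - 1]. *)
Lemma cyclotomic_listP f : f \in cyclotomic_list -> exists d c,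
  [/\ (0 < d < 2 * g)%N, f \is monic, irreducible_poly f, f \is a polyOver OK &
      c \is a polyOver OK /\ 'X^d - 1 = c * f].
Proof.
case/flattenP=> s /mapP[d]; rewrite mem_filter => /andP[dD _] ->.
rewrite mem_undup => /mapP[i]; rewrite mem_filter => /andP[id _] ->.
set f0 := min_poly_over j _; have d0 := D_g_bounds dD.
have f_dvd : f0 %| 'X^d - 1.
  by apply: min_poly_over_unity; rewrite exprAC (prim_expr_order (zeta_prim dD)) expr1n.
have f_monic : f0 \is monic by apply: min_poly_over_monic.
have Xd_int : map_poly intr ('X^d - 1 : {poly int}) = 'X^d - 1 :> {poly K}.
  by rewrite rmorphB /= map_polyXn rmorph1.
have Xd_monic : ('X^d - 1 : {poly int}) \is monic by apply: monic_Xn_sub_1; case/andP: d0.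
have Xd_monicK : ('X^d - 1 : {poly K}) \is monic by apply: monic_Xn_sub_1; case/andP: d0.
have cE : 'X^d - 1 = ('X^d - 1) %/ f0 * f0 by rewrite divpK.
exists d, (('X^d - 1) %/ f0); split=> //.
- exact: min_poly_over_irreducible.
- by apply: (integral_factor emb f_monic Xd_monic); rewrite Xd_int.
split=> //; apply: (integral_factor emb _ Xd_monic).
  by rewrite -(monicMr _ f_monic) -cE.
by rewrite Xd_int [X in _ %| X]cE dvdp_mulr.
Qed.

(** The minimal polynomials of all powers [w^k] are multiplied with repetition, so the product is a
    multiple of the product of the [X - w^k], which is [X^(2i) - 1]. *)
Lemma unity_factorization i : (0 < i < g)%N -> exists s c,
  [/\ {subset s <= cyclotomic_list}, c \is a polyOver OK &
      \prod_(f <- s) f = c * ('X^(2 * i)%N - 1)].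
Proof.
move=> ig; set m := (2 * i)%N.
have mD : m \in D_g g by rewrite inE /D_g /m; apply/andP; split; [lia|rewrite mul2n odd_double; lia].
have w_prim := zeta_prim mD; set w := zeta m in w_prim.
pose q k := min_poly_over j (w ^+ k).
have q_unity k : q k %| 'X^m - 1.
  by apply: min_poly_over_unity; rewrite exprAC (prim_expr_order w_prim) expr1n.
have q_list k : q k \in cyclotomic_list.
  have := exp_prim_root w_prim k; set d := (m %/ _)%N => wk_prim.
  have d0 := prim_order_gt0 wk_prim.
  have dm : (d %| m)%N by apply/dvdnP; exists (gcdn k m); rewrite /d mulnC divnK ?dvdn_gcdr.
  (* The order [d] of [w^k] divides [2i]: if odd it divides [i], below [g]; if even it is at most
     [2i], below [2g]. *)
  have dD : d \in D_g g.
    move: dm; rewrite inE /D_g d0 /m /=; case: (boolP (odd d)) => [d_odd dm|_ /dvdn_leq]; last by lia.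
    have : (d %| i)%N by rewrite -(Gauss_dvdr _ (_ : coprime d 2)) // coprimen2.
    by move/dvdn_leq; lia.
  have [[h hd] /= wkE] := prim_rootP (zeta_prim dD) (prim_expr_order wk_prim).
  apply/flattenP; exists (cyclotomic_factors j (zeta d) d).
    by apply: map_f; rewrite mem_filter dD mem_iota; have := D_g_bounds dD; lia.
  rewrite mem_undup /q wkE; apply: (map_f (fun a => min_poly_over j (zeta d ^+ a))).
  rewrite mem_filter mem_iota hd andbT.
  by rewrite leq0n andbT -(prim_root_exp_coprime _ (zeta_prim dD)) -wkE.
have Xm_monic : ('X^m - 1 : {poly K}) \is monic by apply: monic_Xn_sub_1; rewrite /m; lia.
have prod_monic : \prod_(k <- iota 0 m) q k \is monic.
  by rewrite monic_prod // => k _; apply: min_poly_over_monic.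
have dvd_prod : 'X^m - 1 %| \prod_(k <- iota 0 m) q k.
  rewrite -(dvdp_map j) rmorphB /= map_polyXn rmorph1 -(factor_Xn_sub_1 w_prim).
  rewrite /index_iota subn0 rmorph_prod /=.
  elim: (iota 0 m) => [|k r IHr]; first by rewrite !big_nil dvd1p.
  by rewrite !big_cons dvdp_mul // -root_factor_theorem min_poly_over_root.
exists [seq q k | k <- iota 0 m], (\prod_(k <- iota 0 m) q k %/ ('X^m - 1)).
split; [|  |by rewrite big_map divpK].
  by move=> f /mapP[k _ ->]; apply: q_list.
(* Each of the [m] factors divides [X^m - 1], so the cofactor divides the monic integer polynomial
   [(X^m - 1)^m]. *)
apply: (@integral_factor _ _ emb _ (('X^m - 1) ^+ m)).
- by rewrite -(monicMr _ Xm_monic) divpK.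
- by rewrite rpredX // monic_Xn_sub_1 //; rewrite /m; lia.
rewrite rmorphXn rmorphB /= map_polyXn rmorph1.
apply: (@dvdp_trans _ (\prod_(k <- iota 0 m) q k)).
  by rewrite -[X in _ %| X](divpK dvd_prod) dvdp_mulr.
rewrite -{3}(size_iota 0 m).
elim: (iota 0 m) => [|k r IHr]; first by rewrite big_nil dvd1p.
by rewrite big_cons /= exprS; apply: dvdp_mul (q_unity k) IHr.
Qed.

(* Substituting [(2g)! x] makes every value a unit at the primes above the
   rational primes up to [2g]. *)
Definition scale : K := (2 * g)%N`!%:R.

Lemma scale_neq0 : scale != 0.
Proof. by apply: number_field_natr_neq0; apply: fact_gt0. Qed.

(** The polynomial ['X] makes [x] itself prime; hypothesis H requires distinct polynomials, whence
    [undup]. *)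
Definition schinzel_polys : seq {poly K} :=
  undup ('X :: [seq f \Po (scale *: 'X) | f <- cyclotomic_list]).

Lemma mem_schinzel_polys f : f \in cyclotomic_list ->
  f \Po (scale *: 'X) \in schinzel_polys.
Proof. by move=> fl; rewrite mem_undup inE; apply/orP; right; apply: map_f. Qed.

Lemma schinzel_polys_over f : f \in schinzel_polys -> f \is a polyOver OK.
Proof.
rewrite mem_undup inE => /predU1P[->|/mapP[h /cyclotomic_listP[d [c [_ _ _ hO _]]] ->]].
  exact: polyOverX.
apply: polyOver_comp => //; apply: polyOverZ; rewrite ?polyOverX //.
exact: rpred_nat.
Qed.

Lemma schinzel_polys_irreducible f : f \in schinzel_polys -> irreducible_poly f.
Proof.
rewrite mem_undup inE => /predU1P[->|/mapP[h /cyclotomic_listP[d [c [_ _ hI _ _]]] ->]].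
  by rewrite -['X]subr0; apply: irredp_XsubC.
exact: irreducible_comp_scale scale_neq0 hI.
Qed.

Lemma schinzel_polys_local p : is_prime p ->
  exists2 m, m \in OK & forall f, f \in schinzel_polys -> ~ p f.[m].
Proof.
move=> p_prime; have [l l_prime pl] := prime_rational p_prime.
(* Every value divides [m] or some [(scale * m)^d - 1]. *)
suff [m m_nat [npm npX]] : exists2 m : nat, (0 < m)%N & ~ p m%:R /\
    forall d, (0 < d < 2 * g)%N -> ~ p ((scale * m%:R) ^+ d - 1).
  exists m%:R; first exact: rpred_nat.
  move=> f; rewrite mem_undup inE => /predU1P[->|]; first by rewrite hornerX.
  case/mapP=> h /cyclotomic_listP[d [c [d_bd _ _ _ [cO cE]]]] ->.
  rewrite horner_comp hornerZ hornerX => ph; apply: (npX d d_bd).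
  have := congr1 (fun r => r.[scale * m%:R]) cE; rewrite /= hornerM !hornerE => ->.
  by apply: primeMl => //; apply: rpred_horner; rewrite // rpredM ?rpred_nat.
have [l_small|l_big] := leqP l (2 * g)%N.
  (* As [scale] lies in [p], [scale^d - 1] is -1 modulo [p]. *)
  exists 1%N => //; split=> [|d /andP[d0 _]]; first exact: prime1.
  have p_scale : p scale.
    have /dvdnP[a aE] : (l %| (2 * g)`!)%N by apply: dvdn_fact; rewrite prime_gt0.
    by rewrite /scale aE natrM; apply: primeMl; rewrite ?rpred_nat.
  rewrite mulr1 -(prednK d0) exprSr => pX; apply: (prime1 p_prime).
  rewrite -[1]opprK; apply: primeN => //; apply: (primeDr p_prime pX).
  by apply: primeMl; rewrite ?rpredX ?rpred_nat.
have [z z_prim] := exists_primitive_root l_prime.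
have l_char := pchar_Fp l_prime.
have l1 := prime_gt1 l_prime.
have N0 : (2 * g)%N`!%:R != 0 :> 'F_l.
  by rewrite -(dvdn_pcharf l_char) prime_dvdn_fact.
have z0 : z != 0.
  apply/eqP => z0; have := prim_expr_order z_prim; rewrite z0 expr0n.
  by rewrite -subn1 subn_eq0 leqNgt l1 /= => /eqP; rewrite eq_sym oner_eq0.
(* Thus [scale * m] reduces to the primitive root [z], whose order [l - 1] exceeds every
   [d < 2g]. *)
pose m : nat := (z / (2 * g)%N`!%:R : 'F_l).
have mE : m%:R = z / (2 * g)%N`!%:R :> 'F_l by rewrite /m natr_Zp.
have m0 : m%:R != 0 :> 'F_l by rewrite mE mulf_neq0 ?invr_eq0.
have m_gt0 : (0 < m)%N by rewrite lt0n; apply: contraNneq m0 => ->.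
exists m => //; split=> [pm|d /andP[d0 d_lt] pX].
  by case/negP: m0; rewrite -(dvdn_pcharf l_char) (prime_nat_dvd p_prime).
have Nm0 : (0 < ((2 * g)`! * m) ^ d)%N by rewrite expn_gt0 muln_gt0 fact_gt0 m_gt0.
move: pX; rewrite /scale -natrM -natrX -(natrB _ Nm0).
move/(prime_nat_dvd p_prime l_prime pl); rewrite (dvdn_pcharf l_char) natrB //.
rewrite natrX natrM mE mulrC divfK // subr_eq0 -(prim_order_dvd z_prim).
by move/dvdn_leq; lia.
Qed.

End CyclotomicValues.

(** * Counting the exceptional primes *)

Lemma finite_card_bound (T : choiceType) (S : set T) (s : seq T) :
  (S `<=` [set` s])%classic -> exists2 m, (m <= size s)%N & (S #= `I_m)%card.
Proof.
move=> Ss; have [m Sm] : finite_set S by apply: sub_finite_set Ss _; apply: finite_seq.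
exists m => //; rewrite -card_le_II -(card_le_eql Sm).
apply: (card_le_trans (subset_card_le Ss)).
case: s {Ss} => [|x0 s].
  by rewrite (_ : [set` [::]] = set0)%classic ?card_le0x //; apply/seteqP; split.
apply: card_le_trans (card_image_le (nth x0 (x0 :: s)) _).
by apply: subset_card_le => x /(nthP x0)[i si <-]; exists i.
Qed.

Section ExceptionalPrimes.
Variables (K : fieldExtType rat) (n g : nat).
Hypotheses (dimK : \dim {:K} = n) (g_ge2 : (2 <= g)%N).
Variables (Kbar : closedFieldType) (emb : {rmorphism K -> Kbar}).
Variables (L : fieldExtType rat) (j : 'AHom(K, L)) (zeta : nat -> L).
Hypothesis zeta_prim : forall d, d \in D_g g -> d.-primitive_root (zeta d).
Local Notation OK := (integers_pred K).
Local Notation fs := (schinzel_polys g j zeta).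
Local Notation curve x := (branch_curve g (scale K g * x)).

Lemma small_primes_list : exists2 s : seq (set K), (size s <= n * prime_pi (2 * g))%N &
  forall p q, is_prime p -> prime q -> (q <= 2 * g)%N -> p q%:R -> p \in s.
Proof.
have /choice[A AP] q : exists s : seq (set K), prime q ->
    (size s <= n)%N /\ forall p, is_prime p -> p q%:R -> p \in s.
  have [q_prime|] := boolP (prime q); last by exists [::].
  by have [s sn sP] := primes_above_finite K q_prime; exists s; rewrite -dimK.
exists (flatten [seq A q | q <- iota 0 (2 * g).+1%N & prime q]) => [|p q p_prime q_prime qg pq].
  rewrite /prime_pi -size_filter size_flatten /shape -map_comp.
  have := filter_all prime (iota 0 (2 * g).+1%N); elim: (filter _ _) => //= q r IHr.
  case/andP=> q_prime /IHr{}IHr; rewrite mulnS leq_add //.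
  by have [] := AP q q_prime.
apply/flattenP; exists (A q); last by have [_ ->] := AP q q_prime.
by apply: map_f; rewrite mem_filter q_prime mem_iota /= add0n ltnS.
Qed.

Lemma prime_element_prime (x : K) : prime_element x -> is_prime (principal_ideal x).
Proof. by case. Qed.

Lemma prime_element_neq0 (x : K) : prime_element x -> x != 0.
Proof.
case=> _ [_ [y [a _ <-] ax0] _ _]; apply: contraNneq ax0 => ->.
by rewrite mulr0.
Qed.

Lemma prime_element_ideal (x : K) (p : set K) : prime_element x -> is_prime p -> p x ->
  p = principal_ideal x.
Proof.
move=> x_prime p_prime px; apply/esym/(prime_maximal p_prime) => [|_ [a aO <-]].
  exact: prime_element_prime.
by apply: primeMl px => //; apply/integersP.
Qed.

Section Curve.
Variable x : K.
Hypotheses (xO : x \in OK) (x_prime : forall f, f \in fs -> prime_element f.[x]).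
Local Notation t := (scale K g * x).

Lemma branch_parameter_integer : t \in OK.
Proof. by rewrite rpredM ?rpred_nat. Qed.

Lemma parameter_prime_element : prime_element x.
Proof. by rewrite -[x]hornerX; apply: x_prime; rewrite mem_undup mem_head. Qed.

Lemma cyclotomic_value_prime f : f \in cyclotomic_list g j zeta -> prime_element f.[t].
Proof.
move=> fl; have := x_prime (mem_schinzel_polys fl).
by rewrite horner_comp hornerZ hornerX.
Qed.

Lemma unity_value i : (0 < i < g)%N -> exists s c,
  [/\ {subset s <= cyclotomic_list g j zeta}, c \in OK &
      \prod_(f <- s) f.[t] = c * (t ^+ (2 * i) - 1)].
Proof.
move=> ig; have [s [c [sl cO sc]]] := unity_factorization g_ge2 emb j zeta_prim ig.
exists s, c.[t]; split=> //; first exact: rpred_horner branch_parameter_integer.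
by rewrite -horner_prod sc !hornerE.
Qed.

(** If [t^(2i)] were 1, a product of prime elements, all nonzero, would vanish. *)
Lemma branch_parameter_uniq : uniq (branch_points g t).
Proof.
apply: uniq_branch_points.
- exact: number_field_natr_neq0.
- by rewrite mulf_neq0 ?scale_neq0 // prime_element_neq0 //; apply: parameter_prime_element.
move=> i /unity_value[s [c [sl cO sc]]]; apply/eqP => ti.
have : \prod_(f <- s) f.[t] == 0 by rewrite sc ti subrr mulr0.
rewrite prodf_seq_eq0 => /hasP[f fs /= f0].
by have := prime_element_neq0 (cyclotomic_value_prime (sl f fs)); rewrite f0.
Qed.

Lemma curve_good_reduction (s : seq (set K)) (p : set K) :
    (forall p q, is_prime p -> prime q -> (q <= 2 * g)%N -> p q%:R -> p \in s) ->
    is_prime p -> p \notin s ++ [seq principal_ideal f.[x] | f <- fs] ->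
  potentially_good_reduction g p (curve x).
Proof.
move=> sP p_prime; rewrite mem_cat negb_or => /andP[ps pf].
have npq q : prime q -> (q <= 2 * g)%N -> ~ p q%:R.
  by move=> q_prime qg pq; rewrite (sP p q) in ps.
have npf f : f \in fs -> ~ p f.[x].
  move=> ff pfx; case/negP: pf; apply/mapP; exists f => //.
  exact: prime_element_ideal (x_prime ff) p_prime pfx.
have npx : ~ p x by rewrite -[x]hornerX; apply: npf; rewrite mem_undup mem_head.
(* The prime divisors of [(2g)!] are at most [2g]. *)
have np_scale : ~ p (scale K g).
  have [l l_prime pl] := prime_rational p_prime.
  move/(prime_nat_dvd p_prime l_prime pl) => l_dvd.
  apply: (npq l l_prime _ pl); rewrite leqNgt; apply/negP => l_big.
  by rewrite prime_dvdn_fact in l_dvd.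
apply: (good_reduction_branch_curve branch_parameter_integer branch_parameter_uniq p_prime).
- by apply: npq; rewrite //; lia.
- by case/(prime_mul p_prime); rewrite ?rpred_nat.
move=> i /unity_value[r [c [rl cO rc]]] pt.
have : p (\prod_(f <- r) f.[t]) by rewrite rc; apply: primeMl.
case/(prime_prod p_prime) => f fr => [|pft].
  by have [/integersP] := cyclotomic_value_prime (rl f fr).
apply: (npf (f \Po (scale K g *: 'X))); first exact/mem_schinzel_polys/rl.
by rewrite horner_comp hornerZ hornerX.
Qed.

End Curve.

(** The number of exceptional primes varies with [x] but is at most [M], so some single [m] serves
    infinitely many classes. *)
Lemma infinitely_many_bounded (hS : schinzel_hypothesis K) :
  exists2 m, (m <= n * prime_pi (2 * g) + size fs)%N & infinitely_many_classes g emb m.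
Proof.
have [s s_size sP] := small_primes_list.
set M := (_ + _)%N.
pose A := [set x : K | ring_of_integers K x /\
  forall f, f \in fs -> prime_element f.[x]]%classic.
have A_inf : infinite_set A.
  apply: hS => [|f ff|p p_prime]; first exact: undup_uniq.
    have fI := schinzel_polys_irreducible g_ge2 emb zeta_prim ff.
    split; [|by case: fI|by []].
    have /polyOverP fO := schinzel_polys_over g_ge2 emb zeta_prim ff.
    by move=> i; apply/integersP/fO.
  have [m mO mP] := schinzel_polys_local g_ge2 emb j zeta_prim p_prime.
  exists m; first exact/integersP.
  have fO f : f \in fs -> f.[m] \in OK.
    by move=> ff; apply: rpred_horner mO; exact: (schinzel_polys_over g_ge2 emb zeta_prim ff).
  apply/(prime_valuation0 p_prime); split; first by rewrite big_seq rpred_prod.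
  by case/(prime_prod p_prime) => // f ff; apply: mP.
have AP x : A x -> x \in OK /\ forall f, f \in fs -> prime_element f.[x].
  by case=> /integersP.
pose C (m : nat) := [set C : weq K | [/\ hyperelliptic_curve g emb C,
  rational_weierstrass_points g emb C & potentially_good_outside g m C]]%classic.
have AC x : A x -> exists2 m, (m <= M)%N & C m (curve x).
  case/AP=> xO xP; have tO := branch_parameter_integer xO.
  have ut := branch_parameter_uniq xO xP.
  (* Primality is imposed since [s] is only known to contain the small primes; this is why the
     cardinal of [S] is bounded but not fixed. *)
  pose S := [set p : set K | is_prime p /\ p \in s ++ [seq principal_ideal f.[x] | f <- fs]]%classic.
  have [m mM Sm] : exists2 m, (m <= size (s ++ [seq principal_ideal f.[x] | f <- fs]))%N &
      (S #= `I_m)%card by apply: finite_card_bound => p [].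
  exists m; first by rewrite (leq_trans mM) // size_cat size_map leq_add2r.
  split; [exact: hyperelliptic_branch_curve|exact: rational_branch_curve|].
  exists S; split=> // [p []//|p p_prime nSp].
  apply: (curve_good_reduction xO xP sP p_prime); apply/negP => ps.
  by apply: nSp.
(* Each class has finitely many parameters [x], by [finite_isomorphic_branch_curves] over [Kbar]. *)
have cls_inf : infinite_set [set geometric_class g emb (curve x) | x in A]%classic.
  move=> T_fin; apply: A_inf.
  pose fibre c := [set x | A x /\ geometric_class g emb (curve x) = c]%classic.
  have -> : A = (\bigcup_(c in [set geometric_class g emb (curve x) | x in A]) fibre c)%classic.
    apply/seteqP; split=> [x Ax|x [c _ [Ax _]] //].
    by exists (geometric_class g emb (curve x)) => //; exists x.
  apply: bigcup_finite => // _ [x0 Ax0 <-].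
  have [x0O x0P] := AP x0 Ax0.
  have ut0 := branch_parameter_uniq x0O x0P.
  pose h x := emb (scale K g * x).
  have h_inj : injective h by move=> x y /fmorph_inj/(mulfI (scale_neq0 K g)).
  have fin := finite_isomorphic_branch_curves g_ge2 (closure_two_neq0 emb)
    (uniq_iota_branch_points ut0 emb).
  apply: (sub_finite_set (B := (h @^-1` _)%classic)); last first.
    by apply: finite_preimage fin => x y _ _; apply: h_inj.
  move=> x [Ax eq_c]; have [xO xP] := AP x Ax; have ut := branch_parameter_uniq xO xP.
  split; first exact: uniq_iota_branch_points.
  have : geometric_class g emb (curve x0) (curve x0).
    split; first exact: hyperelliptic_branch_curve.
    rewrite map_branch_curve; apply: isomorphic_refl => //.
    exact: uniq_iota_branch_points.
  by rewrite -eq_c => -[_]; rewrite !map_branch_curve.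
(* Pigeonhole: if each [m] up to [M] had finitely many classes, so would their union. *)
apply: contrapT => no_m; apply: cls_inf.
apply: (sub_finite_set (B := (\bigcup_(m in `I_M.+1) [set geometric_class g emb D | D in C m])%classic)).
  move=> _ [x Ax <-]; have [m mM Cm] := AC x Ax.
  by exists m => //; exists (curve x).
apply: bigcup_finite => [|m mM]; first exact: finite_II.
by apply: contrapT => m_inf; apply: no_m; exists m.
Qed.

(** The final 1 counts the polynomial ['X]. *)
Lemma card_schinzel_polys : (size fs)%:R <=
  \sum_(0 <= d < 2 * g | d \in D_g g)
     n%:R / (\dim_(<<1; zeta d>>%VS) <<limg j; zeta d>>%VS)%:R + 1 :> rat.
Proof.
have : (size fs <= (size (cyclotomic_list g j zeta)).+1)%N.
  by rewrite (leq_trans (size_undup _)) //= size_map.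
rewrite -(ler_nat rat) => /le_trans; apply; rewrite -addn1 natrD lerD2r.
rewrite size_flatten /shape -map_comp sumnE big_map big_filter natr_sum.
rewrite /index_iota subn0; apply: ler_sum => d dD /=.
exact: card_cyclotomic_factors dimK (zeta_prim dD).
Qed.

End ExceptionalPrimes.

(** * Existence of the least number of exceptional primes, and its bound *)

Theorem theorem16 (K : fieldExtType rat) (n : nat) (hn : \dim {:K} = n)
  (g : nat) (hg : (2 <= g)%N)
  (Kbar : closedFieldType) (iota : {rmorphism K -> Kbar})
  (hKbar : forall x : Kbar, algebraicOver iota x)
  (L : fieldExtType rat) (j : 'AHom(K, L)) (zeta : nat -> L)
  (hzeta : forall d : nat, d \in D_g g -> d.-primitive_root (zeta d))
  (hSchinzel : schinzel_hypothesis K) :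
  exists c : nat, is_c_K g iota c /\
    (c%:R : rat) <=
      \sum_(0 <= d < 2 * g | d \in D_g g)
         n%:R / (\dim_(<<1; zeta d>>%VS) <<limg j; zeta d>>%VS)%:R
      + 1 + n%:R * (prime_pi (2 * g))%:R.
Proof.
have [m mM m_inf] := infinitely_many_bounded hn hg iota j hzeta hSchinzel.
(* The admissible numbers form a nonempty set of naturals, whose minimum is [c_K(g)]. *)
pose P c := `[< infinitely_many_classes g iota c >].
have exP : exists c, P c by exists m; apply/asboolP.
case: (ex_minnP exP) => c /asboolP c_inf c_min.
exists c; split; first by split=> // i i_inf; apply: c_min; apply/asboolP.
have : (c <= n * prime_pi (2 * g) + size (schinzel_polys g j zeta))%N.
  by apply: leq_trans mM; apply: c_min; apply/asboolP.
rewrite -(ler_nat rat) => /le_trans; apply; rewrite natrD natrM addrC lerD2r.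
exact: card_schinzel_polys.
Qed.
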